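(* If $\mathcal{C}$ is a family of quantum circuits that does not admit a poly-box, then $\mathcal{C}$ does not admit an $\epsilon$-simulator.
   Context: $\mathcal{C}=\{c_a:a\in\mathcal{A}^*\}$ is a uniform family of quantum circuits; $c_a$ acts on $n$ qubits (size and description $\mathrm{poly}(n)$) and $\mathcal{P}_a$ is the Born-rule distribution of its outcome in $\{0,1\}^{k_a}$. For $S\in\{0,1,\bullet\}^{k_a}$, $S$ denotes the set of strings agreeing with $S$ at non-$\bullet$ positions. A poly-box over $\mathcal{C}$ is a classical randomized algorithm that, for all $a$, $\epsilon,\delta>0$ and $S\in\{0,1,\bullet\}^{k_a}$, outputs an estimate $\hat p$ of $p=\mathcal{P}_a(S)$ with $\Pr(|p-\hat p|\ge\epsilon)\le\delta$, in run-time $O(\mathrm{poly}(n,\epsilon^{-1},\log\delta^{-1}))$, with outputs independent of prior outputs. An $\epsilon$-simulator of $\mathcal{C}$ is a classical randomized algorithm that for all $\epsilon>0$ and all $a$ samples from a distribution within $L_1$ distance $\epsilon$ of $\mathcal{P}_a$ in run-time $O(\mathrm{poly}(n,1/\epsilon))$. *)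

(* Defs.v *)
From HB Require Import structures.
From mathcomp Require Import all_boot all_order all_algebra.
From mathcomp Require Import boolp reals.
Set Implicit Arguments. Unset Strict Implicit. Unset Printing Implicit Defensive.
Import Order.TTheory GRing.Theory Num.Theory.
Local Open Scope ring_scope.

(* Families of outcome distributions  P_a on {0,1}^{k_a}  indexed by circuit  *)
(* descriptions a in A^*.                          *)
Record circuit_family (A : finType) (R : realType) := CircuitFamily {
  nqubits : seq A -> nat;
  nout    : seq A -> nat;
  Pdist   : forall a : seq A, (nout a).-tuple bool -> R;
  Pdist_ge0 : forall a x, 0 <= @Pdist a x;
  Pdist_sum1 : forall a, \sum_(x : (nout a).-tuple bool) @Pdist a x = 1;
  (* size and description of c_a are poly(n): |a| and k_a are poly(n) *)
  desc_poly : exists c e : nat, forall a, (size a + nout a <= c * (nqubits a).+1 ^ e)%N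
}.
Arguments nqubits {A R} c a : rename.
Arguments nout {A R} c a : rename.
Arguments Pdist {A R} c a x : rename.

(* S in {0,1,•}^{k_a}: Some b = fixed bit, None = • ; P_a(S) = P_a(set of S) *)
Definition agrees k (S : k.-tuple (option bool)) (x : k.-tuple bool) : bool :=
  [forall i : 'I_k, if tnth S i is Some b then tnth x i == b else true].

Definition marginal (A : finType) (R : realType) (C : circuit_family A R)
  (a : seq A) (S : (nout C a).-tuple (option bool)) : R :=
  \sum_(x : (nout C a).-tuple bool | agrees S x) Pdist C a x.

Definition sym (A : finType) : finType := (A + 'I_4)%type.
Definition sA (A : finType) (x : A) : sym A := inl x.
Definition s0 {A : finType} : sym A := inr (@Ordinal 4 0 isT).
Definition s1 {A : finType} : sym A := inr (@Ordinal 4 1 isT).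
Definition sdot {A : finType} : sym A := inr (@Ordinal 4 2 isT).
Definition ssep {A : finType} : sym A := inr (@Ordinal 4 3 isT).
Definition sbit {A : finType} (b : bool) : sym A := if b then s1 else s0.

Inductive move := MoveL | MoveR | Stay.

(* Tape alphabet: None = blank, Some (inl s) = input/output symbol,          *)
(* Some (inr w) = machine-specific work symbol.                              *)
Record PTM (Sig : finType) := MkPTM {
  state : finType;
  work : finType;
  start : state;
  halting : pred state;
  trans : state -> option (Sig + work) -> bool (* coin flip *) ->
          state * option (Sig + work) * move
}.

Definition tsym Sig (M : PTM Sig) := option (Sig + work M).

(* configuration: state, reversed left part, scanned cell, right part *)
Record config Sig (M : PTM Sig) := Config {
  cstate : state M; cleft : seq (tsym M); ccur : tsym M; cright : seq (tsym M)
}.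
Arguments Config {Sig M}.

Definition init_config Sig (M : PTM Sig) (x : seq Sig) : config M :=
  match x with
  | [::] => Config (start M) [::] None [::]
  | s :: x' => Config (start M) [::] (Some (inl s)) [seq Some (inl t) | t <- x']
  end.

Definition step Sig (M : PTM Sig) (c : config M) (coin : bool) : config M :=
  if @halting Sig M (cstate c) then c else
  let: (q', g, mv) := trans (cstate c) (ccur c) coin in
  match mv with
  | Stay => Config q' (cleft c) g (cright c)
  | MoveR => match cright c with
             | [::] => Config q' (g :: cleft c) None [::]
             | h :: r => Config q' (g :: cleft c) h r
             end
  | MoveL => match cleft c with
             | [::] => Config q' [::] None (g :: cright c)
             | h :: l => Config q' l h (g :: cright c)
             end
  end.

Definition run Sig (M : PTM Sig) (x : seq Sig) (r : seq bool) : config M :=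
  foldl (@step Sig M) (init_config M x) r.

Fixpoint out_word Sig (M : PTM Sig) (w : seq (tsym M)) : seq Sig :=
  match w with
  | Some (inl s) :: w' => s :: out_word w'
  | _ => [::]
  end.

Definition output Sig (M : PTM Sig) (c : config M) : seq Sig :=
  out_word (ccur c :: cright c).

Definition halts_within Sig (M : PTM Sig) (x : seq Sig) (T : nat) : Prop :=
  forall r : T.-tuple bool, @halting Sig M (cstate (run M x r)).

Definition prob_out (R : realType) Sig (M : PTM Sig) (x : seq Sig) (T : nat)
  (E : seq Sig -> Prop) : R :=
  (#|[set r : T.-tuple bool | `[< E (output (run M x r)) >] ]|%:R / (2 ^ T)%:R).

(* binary, least significant bit first, no leading zeros (0 = empty word) *)
Fixpoint bin_aux (fuel n : nat) : seq bool :=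
  match fuel with
  | 0 => [::]
  | f.+1 => if n == 0%N then [::] else odd n :: bin_aux f n./2
  end.
Definition bin (n : nat) : seq bool := bin_aux n n.

Definition enc_nat {A : finType} (n : nat) : seq (sym A) := map sbit (bin n).
Definition enc_int {A : finType} (z : int) : seq (sym A) :=
  match z with
  | Posz n => s0 :: enc_nat n
  | Negz n => s1 :: enc_nat n.+1
  end.
Definition enc_frac {A : finType} (z : int) (d : nat) : seq (sym A) :=
  enc_int z ++ ssep :: enc_nat d.
Definition enc_bits {A : finType} (x : seq bool) : seq (sym A) := map sbit x.
Definition enc_S {A : finType} (S : seq (option bool)) : seq (sym A) :=
  [seq if o is Some b then sbit b else sdot | o <- S].

(* poly-box input (a, eps = 1/m, delta = 1/d, S) ; simulator input (a, eps = 1/m) *)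
Definition enc_box {A : finType} (a : seq A) (m d : nat) (S : seq (option bool))
  : seq (sym A) :=
  map (@sA A) a ++ ssep :: enc_nat m ++ ssep :: enc_nat d ++ ssep :: enc_S S.
Definition enc_sim {A : finType} (a : seq A) (m : nat) : seq (sym A) :=
  map (@sA A) a ++ ssep :: enc_nat m.

Definition poly_box (A : finType) (R : realType) (C : circuit_family A R) : Prop :=
  exists (M : PTM (sym A)) (c e : nat),
  forall (a : seq A) (m d : nat) (S : (nout C a).-tuple (option bool)),
    (0 < m)%N -> (0 < d)%N ->
    let x := enc_box a m d S in
    let T := (c * (nqubits C a + m + up_log 2 d).+1 ^ e)%N in
    halts_within M x T /\
    prob_out R M x T
      (fun w => ~ exists (z : int) (dd : nat),
                    [/\ (0 < dd)%N, w = enc_frac z dd &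
                        `|marginal S - (z%:~R / dd%:R)| < (m%:R)^-1])
    <= (d%:R)^-1.

Definition eps_simulator (A : finType) (R : realType) (C : circuit_family A R)
  : Prop :=
  exists (M : PTM (sym A)) (c e : nat),
  forall (a : seq A) (m : nat), (0 < m)%N ->
    let x := enc_sim a m in
    let T := (c * (nqubits C a + m).+1 ^ e)%N in
    halts_within M x T /\
    (* L1 distance between P_a and the output distribution (invalid outputs *)
    (* count fully) is at most eps = 1/m *)
    \sum_(y : (nout C a).-tuple bool)
        `|Pdist C a y - prob_out R M x T (fun w => w = enc_bits y)|
      + prob_out R M x T
          (fun w => ~ exists y : (nout C a).-tuple bool, w = enc_bits y)
    <= (m%:R)^-1.

(* Main.v *)
(** The estimator runs the simulator N times on the same input with precision
    1/m' < 1/(2m), counts how often the sample fits S, and outputs hits/N.  The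
    hit probability p of one run satisfies |P_a(S) - p| <= 1/m', so the output is
    wrong only if hits/N deviates from p by at least 1/(2m); since N is at least
    32 m^2 (log d + 1), a Chernoff bound makes this as unlikely as 1/d.

    The Turing machine is realised by left-right sweeps over a multi-track tape.
    The simulated machine is kept as two stacks whose tops sit at the left end, so
    one simulated step is one sweep (push on the way right, pop on the way left),
    and its output is always aligned with S.

    The runs consume random numbers of coins, so the error is not computed from a
    product distribution: the exponential moment of the hit count is carried as a
    bound that is a supermartingale along the computation. *)
Require Import Defs.
From HB Require Import structures.
From mathcomp Require Import all_boot all_order all_algebra.
From mathcomp Require Import boolp reals sequences exp zify ring lra.
Set Implicit Arguments. Unset Strict Implicit. Unset Printing Implicit Defensive.
Import Order.TTheory GRing.Theory Num.Theory.
Local Open Scope ring_scope.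

(** * Coin-driven transition systems *)

(** The only arithmetic that the machine performs is adding one. The precision 1/m' and the number N
    of runs are read off bit lengths: |bin m| fixes m up to a factor 2, so 128^|bin m| lies between
    32 m^2 and (2m)^7, and the bits of d supply the factor log d in unary. No division occurs, since
    the output fraction need not be reduced: its numerator and denominator are two binary counters.
    Each of these updates is a finite-state pass along the tape.

    The 32 comes from the exponential moments: with t = 1/(2m) and parameter s = t/4, both tails
    together are at most 2 exp(-N t^2/8), and N t^2/8 = N/(32 m^2).

    Independence of the runs is never stated about coins. A certificate [bounded] asserts at once
    that all coin sequences halt in time and that the final value has mean at most v. One run turns
    bounds v1 and v0 for the rest of the computation, after a hit and after a miss, into p v1 + (1 -
    p) v0. *)

Lemma half_double (R : realFieldType) (v : R) : (v + v) / 2%:R = v.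
Proof. by rewrite -mulr2n -[v *+ 2]mulr_natr mulfK // pnatr_eq0. Qed.

Section CoinSystems.
Variables (R : realFieldType) (C : Type) (stp : C -> bool -> C) (H : pred C).

Fixpoint expect (F : C -> R) (t : nat) (c : C) : R :=
  if t is t'.+1 then (expect F t' (stp c false) + expect F t' (stp c true)) / 2%:R
  else F c.

(** A finite coin tree whose leaves have halted. Unlike [expect] it fixes no horizon: branches may
    end at different depths, so certificates of successive phases can be grafted onto one
    another. *)
Inductive bounded (F : C -> R) : nat -> C -> R -> Prop :=
| BoundedHalt t c v : H c -> F c <= v -> bounded F t c v
| BoundedStep t c v0 v1 v :
    bounded F t (stp c false) v0 -> bounded F t (stp c true) v1 ->
    (v0 + v1) / 2%:R <= v -> bounded F t.+1 c v.

Lemma bounded_le (F : C -> R) t t' c v v' :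
  bounded F t c v -> (t <= t')%N -> v <= v' -> bounded F t' c v'.
Proof.
move=> B; elim: B t' v' => {t c v} [t c v Hc Fv|t c v0 v1 v _ IH0 _ IH1 le_v] t' v'.
  by move=> _ le_v; apply: BoundedHalt => //; apply: le_trans le_v.
case: t' => // t'; rewrite ltnS => le_t le_v'.
apply: (BoundedStep (IH0 _ _ le_t (lexx _)) (IH1 _ _ le_t (lexx _))).
exact: le_trans le_v'.
Qed.

Lemma bounded_next (F : C -> R) t c v :
  (forall b, bounded F t (stp c b) v) -> bounded F t.+1 c v.
Proof.
move=> B; apply: (BoundedStep (B false) (B true)).
by rewrite half_double.
Qed.

(** Steps whose outcome ignores the coins cost time only. This disposes of all coins that are
    flipped while the head is inside the tape. *)
Lemma bounded_foldl (F : C -> R) k t c c' v :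
  (forall r, size r = k -> foldl stp c r = c') ->
  bounded F t c' v -> bounded F (k + t) c v.
Proof.
elim: k c => [|k IH] c det B; first by rewrite -(det [::]) in B.
rewrite addSn; apply: bounded_next => b; apply: IH B => r sr.
by rewrite -(det (b :: r)) //= sr.
Qed.

Lemma eq_expect (F G : C -> R) t : F =1 G -> expect F t =1 expect G t.
Proof. by move=> FG; elim: t => [|t IH] c //=; rewrite !IH. Qed.

Lemma expectZ (a : R) (F : C -> R) t c :
  expect (fun d => a * F d) t c = a * expect F t c.
Proof. by elim: t c => [|t IH] c //=; rewrite !IH -mulrDr mulrA. Qed.

Lemma expectD (F G : C -> R) t c :
  expect (fun d => F d + G d) t c = expect F t c + expect G t c.
Proof. by elim: t c => [|t IH] c //=; rewrite !IH -mulrDl addrACA. Qed.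

Lemma expect_const (a : R) t c : expect (fun=> a) t c = a.
Proof.
elim: t c => [|t IH] c //=.
by rewrite !IH half_double.
Qed.

Lemma expect_le (F G : C -> R) t c : (forall d, F d <= G d) -> expect F t c <= expect G t c.
Proof.
move=> FG; elim: t c => [|t IH] c //=.
by rewrite ler_pM2r ?invr_gt0 ?ltr0n // lerD ?IH.
Qed.

Lemma expect_sum (I : finType) (P : pred I) (F : I -> C -> R) t c :
  expect (fun d => \sum_(i | P i) F i d) t c = \sum_(i | P i) expect (F i) t c.
Proof.
elim: t c => [|t IH] c //=.
by rewrite !IH -big_split /= mulr_suml.
Qed.
(** Splitting off the first coin matches the recursion of [expect] with the counting definition of
    [prob_out]. *)
Lemma expect_tuple (F : C -> R) t c :
  expect F t c = (\sum_(r : t.-tuple bool) F (foldl stp c r)) / (2 ^ t)%:R.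
Proof.
elim: t c => [|t IH] c /=.
  rewrite expn0 divr1 (big_pred1 [tuple]) // => r.
  by apply/esym/eqP; exact: tuple0.
rewrite !IH -mulrDl expnSr natrM invfM mulrA; congr (_ / _ / _).
pose h (p : bool * t.-tuple bool) := [tuple of p.1 :: p.2].
rewrite (reindex h) /=; last first.
  exists (fun r : t.+1.-tuple bool => (thead r, [tuple of behead r])).
    by move=> [b r] _ /=; congr (_, _); apply: val_inj.
  by move=> r _; rewrite /h /= [RHS]tuple_eta.
rewrite -(pair_big predT predT (fun b (r : t.-tuple bool) => F (foldl stp c (h (b, r))))) /=.
by rewrite big_bool addrC.
Qed.

Hypothesis haltP : forall c b, H c -> stp c b = c.

Lemma foldl_halt c r : H c -> foldl stp c r = c.
Proof. by move=> Hc; elim: r => //= b r; rewrite haltP. Qed.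

Lemma expect_halt (F : C -> R) t c : H c -> expect F t c = F c.
Proof.
move=> Hc; elim: t => //= t IH.
by rewrite !haltP // IH half_double.
Qed.

Lemma bounded_halts (F : C -> R) t T c v r :
  bounded F t c v -> (t <= T)%N -> size r = T -> H (foldl stp c r).
Proof.
move=> B; elim: B T r => {t c v} [t c v Hc _|t c v0 v1 v _ IH0 _ IH1 _] T r.
  by rewrite foldl_halt.
by case: T r => // T [//|[] r] /= le_t [sr]; [apply: IH1 sr | apply: IH0 sr].
Qed.

Lemma bounded_expect (F : C -> R) t T c v :
  bounded F t c v -> (t <= T)%N -> expect F T c <= v.
Proof.
move=> B; elim: B T => {t c v} [t c v Hc Fv|t c v0 v1 v _ IH0 _ IH1 le_v] T.
  by rewrite expect_halt.
case: T => // T le_t /=; apply: le_trans le_v.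
by rewrite ler_pM2r ?invr_gt0 ?ltr0n // lerD ?IH0 ?IH1.
Qed.

(* The continuation bound [V] is averaged over the end of a run whose length    *)
(* depends on the coins.                                                        *)
Lemma bounded_simulation (D : Type) (emb : C -> D -> Prop) (V : C -> R)
    (B : nat -> D -> R -> Prop) n T c d :
  (forall t d' v v', B t d' v -> v <= v' -> B t.+1 d' v') ->
  (forall t c' d', ~~ H c' -> emb c' d' ->
     forall v0 v1,
     (forall d'', emb (stp c' false) d'' -> B t d'' v0) ->
     (forall d'', emb (stp c' true) d'' -> B t d'' v1) ->
     B t.+1 d' ((v0 + v1) / 2%:R)) ->
  (forall c' d', H c' -> emb c' d' -> B n d' (V c')) ->
  (forall r, size r = T -> H (foldl stp c r)) -> emb c d ->
  B (T + n)%N d (expect V T c).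
Proof.
move=> Ble Bstep Bend; elim: T c d => [|T IH] c d halts cd.
  by apply: Bend => //; exact: (halts [::]).
have [Hc|nHc] := boolP (H c).
  (* A run that halts early wastes its remaining steps: the mean is the same with one step less, and
     monotonicity of [B] in time absorbs the difference. *)
  have E : expect V T.+1 c = expect V T c by rewrite !expect_halt.
  rewrite E; apply: Ble (lexx _); apply: IH => // r sr.
  by rewrite foldl_halt.
apply: Bstep cd _ _ _ _ => // d' cd'; apply: IH => // r sr.
  by apply: (halts (false :: r)); rewrite /= sr.
by apply: (halts (true :: r)); rewrite /= sr.
Qed.

End CoinSystems.

Lemma step_halting (Sig : finType) (M : PTM Sig) (c : config M) b :
  halting (cstate c) -> step c b = c.
Proof. by rewrite /step => ->. Qed.

Lemma prob_outE (R : realType) (Sig : finType) (M : PTM Sig) x T E :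
  prob_out R M x T E =
  expect (@step Sig M) (fun c => (`[< E (output c) >])%:R) T (init_config M x).
Proof.
rewrite expect_tuple /prob_out; congr (_ / _).
rewrite -sum1_card natr_sum big_mkcond /=; apply: eq_bigr => r _.
by rewrite inE; case: `[< _ >].
Qed.

(** * Sweeping machines *)

(* A machine whose head only sweeps back and forth over the whole nonblank      *)
(* tape, which gains one fresh cell per sweep.  Coins are read at the left end  *)
(* only; [turn] returns [None] when the next leftward sweep writes the answer.  *)
Record sweeper (Sig : finType) := Sweeper {
  cell : finType;
  fstate : finType;
  bstate : finType;
  blank : cell;
  decode : Sig -> cell;
  finit : fstate;
  fwd : fstate -> cell -> fstate * cell;
  turn : fstate -> option bstate;
  bwd : bstate -> cell -> bstate * cell;
  launch : bstate -> bool -> fstate;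
  display : cell -> option Sig
}.
Arguments blank {Sig s}.
Arguments decode {Sig s}.
Arguments finit {Sig s}.
Arguments fwd {Sig s}.
Arguments turn {Sig s}.
Arguments bwd {Sig s}.
Arguments launch {Sig s}.
Arguments display {Sig s}.

Section Sweeping.
Variables (Sig : finType) (W : sweeper Sig).

Fixpoint fscan (q : fstate W) (w : seq (cell W)) : fstate W * seq (cell W) :=
  if w is c :: w' then
    let: (q1, c1) := fwd q c in let: (q2, w2) := fscan q1 w' in (q2, c1 :: w2)
  else (q, [::]).

Fixpoint bscan (q : bstate W) (w : seq (cell W)) : bstate W * seq (cell W) :=
  if w is c :: w' then
    let: (q1, w1) := bscan q w' in let: (q2, c2) := bwd q1 c in (q2, c2 :: w1)
  else (q, [::]).

(** On the left, the head is on the blank before the tape and about to use the one coin of the next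
    sweep; on the right, the answer has been written. *)
Definition sconfig := ((bstate W * seq (cell W)) + seq (cell W))%type.

Definition finish (q : fstate W) (w : seq (cell W)) : sconfig :=
  let: (q1, w1) := fscan q (rcons w blank) in
  if turn q1 is Some g then inl (bscan g w1) else inr w1.

Definition sstep (c : sconfig) (b : bool) : sconfig :=
  if c is inl (g, w) then finish (launch g b) w else c.

Definition shalt (c : sconfig) : bool := if c is inr _ then true else false.

(** * Sweeps as Turing machine computations *)

Definition swork := cell W.
Definition sstate := (fstate W + bstate W + bool)%type.

Definition ocell (c : Sig + swork) : cell W :=
  match c with inl s => decode s | inr c => c end.

(** Blanks serve as end markers. The right one is overwritten by a coded cell before the head turns,
    which is how the tape grows; the left one is kept. The Boolean states are the final leftward
    sweep that writes the answer ([false]) and the halting state ([true]). *)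
Definition strans (q : sstate) (o : option (Sig + swork)) (b : bool) :
    sstate * option (Sig + swork) * move :=
  match q, o with
  | inl (inl f), None =>
      let: (f', c') := fwd f blank in
      (if turn f' is Some g then inl (inr g) else inr false, Some (inr c'), Stay)
  | inl (inl f), Some c =>
      let: (f', c') := fwd f (ocell c) in (inl (inl f'), Some (inr c'), MoveR)
  | inl (inr g), None => (inl (inl (launch g b)), None, MoveR)
  | inl (inr g), Some c =>
      let: (g', c') := bwd g (ocell c) in (inl (inr g'), Some (inr c'), MoveL)
  | inr false, None => (inr true, None, MoveR)
  | inr false, Some c => (inr false, omap inl (display (ocell c)), MoveL)
  | inr true, _ => (q, o, Stay)
  end.

Definition sweep_ptm : PTM Sig :=
  @MkPTM Sig sstate swork (inl (inl finit)) (fun q => q == inr true) strans.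

Local Notation stp := (@step Sig sweep_ptm).
Local Notation tcell := (tsym sweep_ptm).

Definition at_cell (q : sstate) (l r : seq tcell) : config sweep_ptm :=
  match r with
  | [::] => @Config Sig sweep_ptm q l None [::]
  | h :: r' => @Config Sig sweep_ptm q l h r'
  end.

Definition coded (w : seq (cell W)) : seq tcell := [seq Some (inr c) | c <- w].
Definition shown (w : seq (cell W)) : seq tcell :=
  [seq omap inl (display c) | c <- w].

Definition embed (c : sconfig) : config sweep_ptm :=
  match c with
  | inl (g, w) => @Config Sig sweep_ptm (inl (inr g)) [::] None (coded w)
  | inr w => at_cell (inr true) [:: None] (shown w)
  end.

Lemma fscan_rcons q w c :
  fscan q (rcons w c) =
  let: (q1, w1) := fscan q w in let: (q2, c2) := fwd q1 c in (q2, rcons w1 c2).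
Proof.
elim: w q => [|d w IH] q /=; first by case: (fwd q c).
case: (fwd q d) => q1 d1; rewrite IH; case: (fscan q1 w) => q2 w2.
by case: (fwd q2 c).
Qed.

Lemma bscan_rcons g w c :
  bscan g (rcons w c) =
  let: (g1, c1) := bwd g c in let: (g2, w2) := bscan g1 w in (g2, rcons w2 c1).
Proof.
elim: w => [|d w IH] /=; first by case: (bwd g c).
rewrite IH; case: (bwd g c) => g1 c1; case: (bscan g1 w) => g2 w2.
by case: (bwd g2 d).
Qed.

Lemma size_fscan q w : size (fscan q w).2 = size w.
Proof.
elim: w q => //= c w IH q; case: (fwd q c) => q1 c1.
by have := IH q1; case: (fscan q1 w) => q2 w2 /= ->.
Qed.

Lemma size_bscan g w : size (bscan g w).2 = size w.
Proof.
elim: w => //= c w; case: (bscan g w) => g1 w1 /= <-.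
by case: (bwd g1 c).
Qed.

Lemma step_fwd q l c u b :
  stp (at_cell (inl (inl q)) l (Some c :: u)) b =
  at_cell (inl (inl (fwd q (ocell c)).1)) (Some (inr (fwd q (ocell c)).2) :: l) u.
Proof. by rewrite /step /=; case: (fwd q _) => q1 c1; case: u. Qed.

Lemma foldl_fwd q l (u : seq (Sig + swork)) r : size r = size u ->
  foldl stp (at_cell (inl (inl q)) l (map Some u)) r =
  let: (q1, w1) := fscan q (map ocell u) in
  at_cell (inl (inl q1)) (rev (coded w1) ++ l) [::].
Proof.
elim: u q l r => [|c u IH] q l [|b r] // [sr].
rewrite map_cons [LHS]/= -/(at_cell _ l (_ :: _)) step_fwd IH //=.
case: (fwd q _) => q1 c1 /=; case: (fscan q1 _) => q2 w2 /=.
by rewrite rev_cons cat_rcons.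
Qed.

(** The left stack is empty during the first sweep and holds the left blank during later ones.
    Moving off the tape reads a blank in both cases, so they are treated together. *)
Definition at_edge (l : seq tcell) := l = [::] \/ l = [:: None].

Lemma foldl_bwd g w c l u r : at_edge l -> size r = (size w).+1 ->
  foldl stp (@Config Sig sweep_ptm (inl (inr g)) (rev (coded w) ++ l) (Some (inr c)) u) r =
  let: (g1, w1) := bscan g (rcons w c) in
  @Config Sig sweep_ptm (inl (inr g1)) [::] None (coded w1 ++ u).
Proof.
move=> el; elim/last_ind: w g c u r => [|w d IH] g c u [|b r] //= [].
  case: r => // _ /=; rewrite /step /=.
  by case: (bwd g c) => g1 c1 /=; case: el => ->.
rewrite size_rcons {2}/step /= => sr; rewrite bscan_rcons.
case: (bwd g c) => g1 c1 /=.
rewrite /coded map_rcons rev_rcons /= IH //.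
case: (bscan g1 _) => g2 w2; congr Config.
by rewrite /coded map_rcons cat_rcons.
Qed.

Lemma foldl_show w c l u r : at_edge l -> size r = (size w).+1 ->
  foldl stp (@Config Sig sweep_ptm (inr false) (rev (coded w) ++ l) (Some (inr c)) u) r =
  @Config Sig sweep_ptm (inr false) [::] None (shown (rcons w c) ++ u).
Proof.
move=> el; elim/last_ind: w c u r => [|w d IH] c u [|b r] //= [].
  by case: r => // _ /=; rewrite /step /=; case: el => ->.
rewrite size_rcons {2}/step /= => sr.
by rewrite /coded map_rcons rev_rcons /= IH // /shown !map_rcons !cat_rcons.
Qed.

Lemma foldl_finish q l (u : seq (Sig + swork)) : at_edge l ->
  exists2 k, (k <= (size u).*2 + 3)%N & forall r, size r = k ->
  foldl stp (at_cell (inl (inl q)) l (map Some u)) r = embed (finish q (map ocell u)).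
Proof.
move=> el; rewrite /finish fscan_rcons.
have := size_fscan q (map ocell u); rewrite size_map.
have := @foldl_fwd q l u.
case: (fscan q _) => q1 w1 /= run1 sw.
case E2: (fwd q1 blank) => [q2 c2].
have run2 r : size r = (size u).+1 ->
    foldl stp (at_cell (inl (inl q)) l (map Some u)) r =
    @Config Sig sweep_ptm (if turn q2 is Some g then inl (inr g) else inr false)
      (rev (coded w1) ++ l) (Some (inr c2)) [::].
  case/lastP: r => [//|r b]; rewrite size_rcons => -[sr].
  by rewrite foldl_rcons run1 // /step /= E2.
case Et: (turn q2) run2 => [g|] run2.
  exists ((size u).+1 + (size u).+1)%N; first by lia.
  move=> r sr; rewrite -(cat_take_drop (size u).+1 r) foldl_cat run2; last first.
    by rewrite size_takel // sr leq_addr.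
  rewrite foldl_bwd //; last by rewrite size_drop sr addnK sw.
  by case: (bscan g _) => g2 w2; rewrite cats0.
(* One step more than before a sweep that continues: the head returns from the left blank to the
   first symbol, where the output is read. *)
exists ((size u).+1 + (size u).+2)%N; first by lia.
move=> r sr; rewrite -(cat_take_drop (size u).+1 r) foldl_cat run2; last first.
  by rewrite size_takel // sr leq_addr.
have: size (drop (size u).+1 r) = (size u).+2 by rewrite size_drop sr addKn.
case/lastP: (drop _ _) => [//|r1 b]; rewrite size_rcons => -[sr1].
rewrite foldl_rcons foldl_show ?sw // cats0.
by rewrite /step /=; case: (shown _).
Qed.

Lemma ocell_coded w : map ocell (map inr w) = w.
Proof. by rewrite -map_comp map_id. Qed.

Lemma foldl_sstep g w b :
  exists2 k, (k <= (size w).*2 + 3)%N & forall r, size r = k ->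
  foldl stp (stp (embed (inl (g, w))) b) r = embed (sstep (inl (g, w)) b).
Proof.
have [k le_k run] := @foldl_finish (launch g b) [:: None] (map inr w) (or_intror erefl).
exists k => [|r sr]; first by move: le_k; rewrite size_map.
have -> : stp (embed (inl (g, w))) b =
   at_cell (inl (inl (launch g b))) [:: None] (map Some (map inr w)).
  by rewrite /step /= /coded -map_comp; case: w {run le_k}.
by rewrite run // ocell_coded.
Qed.

Lemma size_finish q w g w1 : finish q w = inl (g, w1) -> size w1 = (size w).+1.
Proof.
rewrite /finish; have := size_fscan q (rcons w blank).
case: (fscan _ _) => q1 w2 /=; case: (turn q1) => // g1.
have := size_bscan g1 w2; case: (bscan g1 w2) => g2 w3 /= s3 s2 [_ <-].
by rewrite s3 s2 size_rcons.
Qed.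

Section Bounds.
Variables (R : realFieldType) (F : seq Sig -> R).

Definition sanswer (c : sconfig) : R :=
  if c is inr w then F (out_word (shown w : seq tcell)) else 0.

Lemma output_shown w :
  output (at_cell (inr true) [:: None] (shown w)) = out_word (shown w : seq tcell).
Proof. by case: w. Qed.

Definition tape_size (c : sconfig) : nat := if c is inl (_, w) then size w else 0.

(** A sweep over k cells takes one step for the coin and at most 2k + 3 others, and the tape never
    exceeds [tape_size c + n] cells within [n] sweeps. *)
Lemma bounded_sweep n c v : bounded sstep shalt sanswer n c v ->
  bounded stp (fun d => halting (cstate d)) (fun d => F (output d))
    (n * ((tape_size c + n).*2 + 4)) (embed c) v.
Proof.
elim=> {n c v} [n [[g w]|w] v //= _ Fv|n c v0 v1 v _ IH0 _ IH1 le_v].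
  apply: BoundedHalt; first by case: (w) => [|? ?] /=; rewrite eqxx.
  by rewrite output_shown.
(* The certificate may also unfold a configuration that has already halted; both successors are then
   the configuration itself. *)
case: c IH0 IH1 => [[g w]|w] /= IH0 IH1; last first.
  have e : v0 / 2%:R + v1 / 2%:R <= v by rewrite -mulrDl.
  have {}IH0 := bounded_le IH0 (leqnn _) (lexx _).
  have nn : (n * ((0 + n).*2 + 4) <= (n.+1 * ((0 + n.+1).*2 + 4)).-1)%N by nia.
  have pos : (0 < n.+1 * ((0 + n.+1).*2 + 4))%N by nia.
  rewrite -(prednK pos).
  have st b : stp (at_cell (inr true) [:: None] (shown w)) b =
              at_cell (inr true) [:: None] (shown w).
    by apply: step_halting; case: (w) => [|? ?] /=; rewrite eqxx.
  apply: (@BoundedStep _ _ _ _ _ _ _ v0 v1) => //; rewrite st.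
    exact: bounded_le IH0 nn (lexx _).
  exact: bounded_le IH1 nn (lexx _).
have half b v' :
    bounded stp (fun d => halting (cstate d)) (fun d => F (output d))
     (n * ((tape_size (finish (launch g b) w) + n).*2 + 4))
     (embed (finish (launch g b) w)) v' ->
    bounded stp (fun d => halting (cstate d)) (fun d => F (output d))
     ((n.+1 * ((size w + n.+1).*2 + 4)).-1)
     (stp (embed (inl (g, w))) b) v'.
  move=> B; have [k le_k run] := foldl_sstep g w b.
  apply: bounded_le (bounded_foldl run B) _ (lexx _).
  case E: (finish _ _) => [[g' w']|w'] /=; last by nia.
  by rewrite (size_finish E); nia.
have pos : (0 < n.+1 * ((size w + n.+1).*2 + 4))%N by nia.
rewrite -(prednK pos).
exact: (BoundedStep (half _ _ IH0) (half _ _ IH1)).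
Qed.

Lemma bounded_from_init x n v :
  bounded sstep shalt sanswer n (finish finit (map decode x)) v ->
  bounded stp (fun d => halting (cstate d)) (fun d => F (output d))
    (n.+1 * ((size x + n.+1).*2 + 4)) (init_config sweep_ptm x) v.
Proof.
move=> B.
have [k le_k run] := @foldl_finish finit [::] (map inl x) (or_introl erefl).
rewrite -!map_comp in run.
have -> : init_config sweep_ptm x =
    at_cell (inl (inl finit)) [::] (map (Some \o inl) x) by case: (x).
apply: bounded_le (bounded_foldl run (bounded_sweep B)) _ (lexx _).
rewrite size_map in le_k; case E: (finish _ _) => [[g' w']|w'] /=; last by nia.
by rewrite (size_finish E) size_map; nia.
Qed.
End Bounds.

Lemma nth_fscan (f : nat -> fstate W) (c1 : nat -> cell W) w :
  (forall i, fwd (f i) (nth blank w i) = (f i.+1, c1 i)) ->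
  fscan (f 0) w = (f (size w), mkseq c1 (size w)).
Proof.
elim: w f c1 => [|c w IH] f c1 fc //=.
rewrite (fc 0) (IH (fun i => f i.+1) (fun i => c1 i.+1)) => [|i]; last exact: (fc i.+1).
by rewrite /mkseq /= (iotaDl 1 0) -map_comp.
Qed.

Lemma nth_bscan (h : nat -> bstate W) (c2 c1 : nat -> cell W) n :
  (forall i, bwd (h i.+1) (c1 i) = (h i, c2 i)) ->
  bscan (h n) (mkseq c1 n) = (h 0, mkseq c2 n).
Proof. by move=> hc; elim: n => [|n IH] //; rewrite !mkseqS bscan_rcons hc IH. Qed.

(** Reading cells by [nth blank] hides the length of the tape, and the backward state is kept only
    through the forward states that it launches. Different routes to the same situation thus become
    equal. *)
Definition holds (q : bool -> fstate W) (c : nat -> cell W) (s : sconfig) : Prop :=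
  exists g w, [/\ s = inl (g, w), launch g =1 q & forall i, nth blank w i = c i].

(* States and written cells are given as functions of the cell position. *)
Lemma holds_finish q w (c c1 c2 : nat -> cell W) f h :
  (forall i, nth blank w i = c i) ->
  f 0 = q ->
  (forall i, fwd (f i) (c i) = (f i.+1, c1 i)) ->
  turn (f (size w).+1) = Some (h (size w).+1) ->
  (forall i, bwd (h i.+1) (c1 i) = (h i, c2 i)) ->
  (forall i, size w < i -> c2 i = blank)%N ->
  holds (launch (h 0)) c2 (finish q w).
Proof.
move=> wc f0 fc tn hc bl; rewrite /finish -f0 (@nth_fscan f c1); last first.
  move=> i; rewrite nth_rcons; case: ltngtP => [_|i_gt|->]; first by rewrite wc.
    by rewrite -(nth_default blank (ltnW i_gt)) wc.
  by rewrite -[blank](nth_default _ (leqnn (size w))) wc.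
rewrite size_rcons tn (nth_bscan _ hc).
exists (h 0), (mkseq c2 (size w).+1); split=> // i.
have [i_lt|i_ge] := ltnP i (size w).+1; first by rewrite nth_mkseq.
by rewrite nth_default ?size_mkseq // bl.
Qed.

(** As the length is hidden, the side conditions are asked at every [n] from which the tape is
    blank. The sweep also crosses the fresh cell [n], so it turns in state [f n.+1]. *)
Lemma holds_sstep q b (c c1 c2 : nat -> cell W) f h s :
  holds q c s ->
  f 0 = q b ->
  (forall i, fwd (f i) (c i) = (f i.+1, c1 i)) ->
  (forall n, (forall i, n <= i -> c i = blank)%N ->
     turn (f n.+1) = Some (h n.+1) /\ forall i, (n < i)%N -> c2 i = blank) ->
  (forall i, bwd (h i.+1) (c1 i) = (h i, c2 i)) ->
  holds (launch (h 0)) c2 (sstep s b).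
Proof.
case=> g [w [-> gq wc]] f0 fc side hc; rewrite -gq in f0.
have [|tn bl] := side (size w); first by move=> i ?; rewrite -wc nth_default.
exact: (holds_finish wc f0 fc tn hc bl).
Qed.

Lemma halts_sstep q b (c c1 : nat -> cell W) f s :
  holds q c s ->
  f 0 = q b ->
  (forall i, fwd (f i) (c i) = (f i.+1, c1 i)) ->
  (forall n, (forall i, n <= i -> c i = blank)%N ->
     turn (f n.+1) = None /\ forall i, (n < i)%N -> c1 i = blank) ->
  exists2 w, sstep s b = inr w & forall i, nth blank w i = c1 i.
Proof.
case=> g [w [-> gq wc]] f0 fc side; rewrite -gq in f0.
have [|tn bl] := side (size w); first by move=> i ?; rewrite -wc nth_default.
rewrite /= /finish -f0 (@nth_fscan f c1); last first.
  move=> i; rewrite nth_rcons; case: ltngtP => [_|i_gt|->]; first by rewrite wc.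
    by rewrite -(nth_default blank (ltnW i_gt)) wc.
  by rewrite -[blank](nth_default _ (leqnn (size w))) wc.
rewrite size_rcons tn; exists (mkseq c1 (size w).+1) => // i.
have [i_lt|i_ge] := ltnP i (size w).+1; first by rewrite nth_mkseq.
by rewrite nth_default ?size_mkseq // bl.
Qed.

End Sweeping.

Lemma out_word_nth (Sig : finType) (M : PTM Sig) (u : seq (tsym M)) (z : seq Sig) :
  (forall i, nth None u i = nth None [seq Some (inl s) | s <- z] i) ->
  out_word u = z.
Proof.
elim: z u => [|s z IH] [|c u] uz //=; try by have := uz 0.
  by have /= -> := uz 0.
have /= -> := uz 0; congr (_ :: _); apply: IH => i; exact: (uz i.+1).
Qed.

(** * The estimator *)

(* The odometer has a digit on each bit of m and a mark, set once, on each bit   *)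
(* of d: 128^|bin m| (|bin d| + 1) runs, and 128^l >= 32 m^2 if l = |bin m|.      *)
Definition radix : nat := 128%N.
Definition digit := ('I_radix + bool)%type.

(** Each full cycle of the digits sets one mark. A carry that survives the whole track means that
    digits and marks are exhausted; this overflow ends the computation. *)
Definition odo_step (carry : bool) (o : option digit) : bool * option digit :=
  if carry then
    match o with
    | Some (inl v) => if insub v.+1 is Some v' then (false, Some (inl v'))
                      else (true, Some (inl ord0))
    | Some (inr false) => (false, Some (inr true))
    | _ => (true, o)
    end
  else (false, o).

Inductive counting (Sig : Type) :=
  Sign | CarryNum | Insert of Sig | SkipNum | CarryDen | Settled.
Arguments Sign {Sig}.
Arguments CarryNum {Sig}.
Arguments SkipNum {Sig}.
Arguments CarryDen {Sig}.
Arguments Settled {Sig}.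

Section CountingFinite.
Variable Sig : finType.
Definition counting_code (c : counting Sig) : (option (option bool) + (Sig + bool))%type :=
  match c with
  | Sign => inl None | CarryNum => inl (Some None)
  | SkipNum => inl (Some (Some false)) | CarryDen => inl (Some (Some true))
  | Insert s => inr (inl s) | Settled => inr (inr true)
  end.
Definition counting_decode (c : option (option bool) + (Sig + bool)) : counting Sig :=
  match c with
  | inl None => Sign | inl (Some None) => CarryNum
  | inl (Some (Some false)) => SkipNum | inl (Some (Some true)) => CarryDen
  | inr (inl s) => Insert s | inr (inr _) => Settled
  end.
Lemma counting_codeK : cancel counting_code counting_decode. Proof. by case. Qed.
HB.instance Definition _ := Equality.copy (counting Sig) (can_type counting_codeK).
HB.instance Definition _ := Choice.copy (counting Sig) (can_type counting_codeK).
HB.instance Definition _ := Countable.copy (counting Sig) (can_type counting_codeK).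
HB.instance Definition _ := Finite.copy (counting Sig) (can_type counting_codeK).
End CountingFinite.

(* [FInit] records the field of the input being read: [None] for a,            *)
(* [Some (Some false)] for m, [Some (Some true)] for d and [Some None] for S.     *)
(* [FShift], [FShift1], [FShift2] are at cells 0, 1 and beyond; in [FCmp v],     *)
(* [v = None] means that the comparison is undecided.                            *)
Inductive fcontrol (S V P : Type) :=
| FInit of option (option bool)
| FShift | FShift1 | FShift2 | FLoad
| FSim of S & bool | FPushL of S & V | FPushR of S & V | FKeep of S
| FCmp of option bool
| FInc of counting P | FCount of counting P & bool.
Arguments FInit {S V P}.
Arguments FShift {S V P}.
Arguments FShift1 {S V P}.
Arguments FShift2 {S V P}.
Arguments FLoad {S V P}.
Arguments FSim {S V P}.
Arguments FPushL {S V P}.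
Arguments FPushR {S V P}.
Arguments FKeep {S V P}.
Arguments FCmp {S V P}.
Arguments FInc {S V P}.
Arguments FCount {S V P}.

(** The pop states carry the content of the cell just left behind, so a leftward sweep moves one
    track by a cell to the left. *)
Inductive bcontrol (S V P : Type) :=
| BPopS of option P | BPopL of S & V | BPopR of S & V | BSim of S
| BShift | BInc | BCount.
Arguments BPopS {S V P}.
Arguments BPopL {S V P}.
Arguments BPopR {S V P}.
Arguments BSim {S V P}.
Arguments BShift {S V P}.
Arguments BInc {S V P}.
Arguments BCount {S V P}.

Section ControlFinite.
Variables S V P : finType.
Definition fcontrol_sum :=
  (option (option bool) + option (option (option bool)) + (S * bool + S * V) +
     (S * V + S) + (option bool + counting P) + (counting P * bool))%type.
Definition fcontrol_code (c : fcontrol S V P) : fcontrol_sum :=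
  match c with
  | FInit k => inl (inl (inl (inl (inl k))))
  | FShift => inl (inl (inl (inl (inr None))))
  | FShift1 => inl (inl (inl (inl (inr (Some None)))))
  | FShift2 => inl (inl (inl (inl (inr (Some (Some None))))))
  | FLoad => inl (inl (inl (inl (inr (Some (Some (Some true)))))))
  | FSim q b => inl (inl (inl (inr (inl (q, b)))))
  | FPushL q v => inl (inl (inl (inr (inr (q, v)))))
  | FPushR q v => inl (inl (inr (inl (q, v))))
  | FKeep q => inl (inl (inr (inr q)))
  | FCmp v => inl (inr (inl v))
  | FInc z => inl (inr (inr z))
  | FCount z o => inr (z, o)
  end.
Definition fcontrol_decode (c : fcontrol_sum) : fcontrol S V P :=
  match c with
  | inl (inl (inl (inl (inl k)))) => FInit k
  | inl (inl (inl (inl (inr None)))) => FShift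
  | inl (inl (inl (inl (inr (Some None))))) => FShift1
  | inl (inl (inl (inl (inr (Some (Some None)))))) => FShift2
  | inl (inl (inl (inl (inr (Some (Some (Some _))))))) => FLoad
  | inl (inl (inl (inr (inl (q, b))))) => FSim q b
  | inl (inl (inl (inr (inr (q, v))))) => FPushL q v
  | inl (inl (inr (inl (q, v)))) => FPushR q v
  | inl (inl (inr (inr q))) => FKeep q
  | inl (inr (inl v)) => FCmp v
  | inl (inr (inr z)) => FInc z
  | inr (z, o) => FCount z o
  end.
Lemma fcontrol_codeK : cancel fcontrol_code fcontrol_decode. Proof. by case. Qed.
HB.instance Definition _ := Equality.copy (fcontrol S V P) (can_type fcontrol_codeK).
HB.instance Definition _ := Choice.copy (fcontrol S V P) (can_type fcontrol_codeK).
HB.instance Definition _ := Countable.copy (fcontrol S V P) (can_type fcontrol_codeK).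
HB.instance Definition _ := Finite.copy (fcontrol S V P) (can_type fcontrol_codeK).

Definition bcontrol_sum := (option P + (S * V + S * V) + (S + bool * bool))%type.
Definition bcontrol_code (c : bcontrol S V P) : bcontrol_sum :=
  match c with
  | BPopS s => inl (inl s)
  | BPopL q v => inl (inr (inl (q, v)))
  | BPopR q v => inl (inr (inr (q, v)))
  | BSim q => inr (inl q)
  | BShift => inr (inr (true, true))
  | BInc => inr (inr (true, false))
  | BCount => inr (inr (false, true))
  end.
Definition bcontrol_decode (c : bcontrol_sum) : bcontrol S V P :=
  match c with
  | inl (inl s) => BPopS s
  | inl (inr (inl (q, v))) => BPopL q v
  | inl (inr (inr (q, v))) => BPopR q v
  | inr (inl q) => BSim q
  | inr (inr (true, true)) => BShift
  | inr (inr (true, false)) => BInc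
  | inr (inr (false, _)) => BCount
  end.
Lemma bcontrol_codeK : cancel bcontrol_code bcontrol_decode. Proof. by case. Qed.
HB.instance Definition _ := Equality.copy (bcontrol S V P) (can_type bcontrol_codeK).
HB.instance Definition _ := Choice.copy (bcontrol S V P) (can_type bcontrol_codeK).
HB.instance Definition _ := Countable.copy (bcontrol S V P) (can_type bcontrol_codeK).
HB.instance Definition _ := Finite.copy (bcontrol S V P) (can_type bcontrol_codeK).
End ControlFinite.

(** Numerals start with the least significant bit, so carries travel with the sweep. A numerator
    that gains a bit makes [Insert] push the separator and the denominator one cell to the right;
    the denominator grows into the blank. *)
Definition counter_step (A : finType) (c : counting (sym A)) (z : option (sym A)) :
    counting (sym A) * option (sym A) :=
  match c with
  | Sign => (CarryNum, z)
  | CarryNum => if z == Some s1 then (CarryNum, Some s0)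
                else if z == Some s0 then (Settled, Some s1)
                else (Insert ssep, Some s1)
  | Insert p => if z is Some s then (Insert s, Some p) else (Settled, Some p)
  | SkipNum => (if z == Some ssep then CarryDen else SkipNum, z)
  | CarryDen => if z == Some s1 then (CarryDen, Some s0) else (Settled, Some s1)
  | Settled => (Settled, z)
  end.

Section Estimator.
Variables (A : finType) (M : PTM (sym A)).
Local Notation Sig := (sym A).
Local Notation tape := (tsym M).

(* The six tracks: the two stacks of the simulated machine, its input, the      *)
(* pattern S, the odometer and the running estimate.                            *)
Definition ecell :=
  (tape * tape * tape * option Sig * option digit * option Sig)%type.
Definition eblank : ecell := (None, None, None, None, None, None).
Definition edecode (s : Sig) : ecell := (None, None, None, Some s, None, None).

Definition efstate := fcontrol (state M) tape Sig.
Definition ebstate := bcontrol (state M) tape Sig.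

(* Second separator of the input becomes a top bit: eps = 1/m is replaced by    *)
(* 1/(m + 2^|bin m|), which is less than 1/(2m), without moving any symbol.     *)
Definition init_step (k : option (option bool)) (s : option Sig) :
    option (option bool) * (tape * option Sig * option digit) :=
  let sep := s == Some ssep in
  match k with
  | None => (if sep then Some (Some false) else None,
             (omap inl s, Some ssep, None))
  | Some (Some false) =>
      if sep then (Some (Some true), (Some (inl s1), Some ssep, None))
      else (k, (omap inl s, Some ssep, Some (inl ord0)))
  | Some (Some true) =>
      if sep then (Some None, (None, Some ssep, None))
      else (k, (None, Some ssep, Some (inr false)))
  | Some None => (k, (None, s, None))
  end.

Definition cmp_step (v : option bool) (r : tape) (s : option Sig) : option bool :=
  if v is Some _ then v else
  match s, r with
  | None, Some (inl _) => Some false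
  | None, _ => Some true
  | Some p, Some (inl t) =>
     if (if p == sdot then (t == s0) || (t == s1) else t == p) then None else Some false
  | Some _, _ => Some false
  end.

Definition load_cell (c : ecell) : ecell :=
  let: (l, r, x, s, o, z) := c in (None, x, x, s, o, z).

(** [FShift] has two roles. While the pattern track starts with [ssep], it drops one such symbol per
    sweep, which brings S to the left end. Otherwise it loads the input of the simulated machine for
    the next run. *)
Definition efwd (f : efstate) (c : ecell) : efstate * ecell :=
  let: (l, r, x, s, o, z) := c in
  match f with
  | FInit k => let: (k', (x', s', o')) := init_step k s in
               (FInit k', (l, r, x', s', o', z))
  | FShift => if s == Some ssep then (FShift1, (l, r, x, s, o, Some s0))
              else (FLoad, load_cell c)
  | FShift1 => (FShift2, (l, r, x, s, o, Some ssep))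
  | FShift2 => (FShift2, c)
  | FLoad => (FLoad, load_cell c)
  | FSim q b =>
      let: (q', g, mv) := trans q r b in
      match mv with
      | Stay => (FKeep q', (l, g, x, s, o, z))
      | MoveR => (FPushL q' l, (g, r, x, s, o, z))
      | MoveL => (FPushR q' g, (l, l, x, s, o, z))
      end
  | FPushL q v => (FPushL q l, (v, r, x, s, o, z))
  | FPushR q v => (FPushR q r, (l, v, x, s, o, z))
  | FKeep q => (FKeep q, c)
  | FCmp v => (FCmp (cmp_step v r s), c)
  | FInc k => let: (k', z') := counter_step k z in (FInc k', (l, r, x, s, o, z'))
  | FCount k b => let: (k', z') := counter_step k z in
                  let: (b', o') := odo_step b o in (FCount k' b', (l, r, x, s, o', z'))
  end.

Definition eturn (f : efstate) : option ebstate :=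
  match f with
  | FInit _ => Some BShift
  | FShift | FShift1 | FShift2 => Some (BPopS None)
  | FLoad => Some (BSim (start M))
  | FSim q _ | FKeep q => Some (BSim q)
  | FPushL q _ => Some (BPopR q None)
  | FPushR q _ => Some (BPopL q None)
  | FCmp v => Some (if v == Some true then BInc else BCount)
  | FInc _ => Some BCount
  | FCount _ carry => if carry then None else Some BShift
  end.

Definition ebwd (g : ebstate) (c : ecell) : ebstate * ecell :=
  let: (l, r, x, s, o, z) := c in
  match g with
  | BPopS v => (BPopS s, (l, r, x, v, o, z))
  | BPopL q v => (BPopL q l, (v, r, x, s, o, z))
  | BPopR q v => (BPopR q r, (l, v, x, s, o, z))
  | _ => (g, c)
  end.

Definition elaunch (g : ebstate) (b : bool) : efstate :=
  match g with
  | BPopS _ | BShift => FShift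
  | BPopL q _ | BPopR q _ | BSim q => if halting q then FCmp None else FSim q b
  | BInc => FInc Sign
  | BCount => FCount SkipNum true
  end.

Definition estimator : sweeper Sig :=
  @Sweeper Sig ecell efstate ebstate eblank edecode (FInit None) efwd eturn ebwd elaunch
    (fun c => c.2).
End Estimator.

(** * Binary counters and the odometer *)

Lemma bin_auxS f n : (n <= f)%N -> bin_aux f.+1 n = bin_aux f n.
Proof.
elim: f n => [|f IH] n; first by rewrite leqn0 => /eqP ->.
move=> n_le; rewrite -[LHS]/(if n == 0%N then [::] else odd n :: bin_aux f.+1 n./2).
by rewrite IH //; lia.
Qed.

Lemma bin_aux_fuel f n : (n <= f)%N -> bin_aux f n = bin n.
Proof.
move=> n_le; rewrite -(subnKC n_le); elim: (f - n)%N => [|k IH]; first by rewrite addn0.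
by rewrite addnS bin_auxS // leq_addr.
Qed.

Lemma bin_rec n : (0 < n)%N -> bin n = odd n :: bin n./2.
Proof. by case: n => // n _; rewrite -(bin_aux_fuel (_ : n.+1./2 <= n)%N) //; lia. Qed.

Fixpoint bsucc (b : seq bool) : seq bool :=
  match b with
  | [::] => [:: true]
  | false :: b' => true :: b'
  | true :: b' => false :: bsucc b'
  end.

Lemma bin_succ n : bin n.+1 = bsucc (bin n).
Proof.
elim/ltn_ind: n => -[|n] IH //; rewrite bin_rec // [in RHS]bin_rec //=.
case: (boolP (odd n)) => on /=; first by rewrite uphalf_half on.
by rewrite IH /= ?uphalf_half ?(negPf on) //; lia.
Qed.

Lemma size_bsucc b : (size (bsucc b) <= (size b).+1)%N.
Proof. by elim: b => [|[] b IH]. Qed.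

Lemma bin_lt_exp n : (n < 2 ^ size (bin n))%N.
Proof.
elim/ltn_ind: n => -[|n] IH //; rewrite bin_rec //=.
have lt_half: (n.+1./2 < n.+1)%N by lia.
by rewrite expnS; have := IH _ lt_half; move: (2 ^ _)%N => e; lia.
Qed.

Lemma exp_size_bin n : (0 < n)%N -> (2 ^ size (bin n) <= n.*2)%N.
Proof.
elim/ltn_ind: n => n IH n_gt0; rewrite bin_rec //= expnS.
have [/IH|] := ltnP 0 n./2; first by lia.
by rewrite leqn0 => /eqP ->; rewrite expn0; lia.
Qed.

Lemma bin_addtop n : (0 < n)%N -> bin (n + 2 ^ size (bin n)) = rcons (bin n) true.
Proof.
elim/ltn_ind: n => n IH n_gt0; rewrite [bin n]bin_rec //= expnS.
rewrite bin_rec; last by lia.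
have -> : (n + 2 * 2 ^ size (bin n./2))./2 = (n./2 + 2 ^ size (bin n./2))%N by lia.
rewrite oddD oddM addbF; congr (_ :: _).
have [/IH ->|] := ltnP 0 n./2; [by [] | lia |].
by rewrite leqn0 => /eqP ->.
Qed.

(** * Finite-state rewriting of a track *)

Section Transducers.
Variables (S P Q : Type) (tz : S -> option P -> S * Q).

(** The word is prolonged by blanks, so [i] may exceed its length; this yields states at all cell
    positions, as [holds_sstep] wants them. *)
Definition state_at (q : S) (u : seq (option P)) (i : nat) : S :=
  foldl (fun k y => (tz k y).1) q (mkseq (nth None u) i).

Lemma state_atS q u i : state_at q u i.+1 = (tz (state_at q u i) (nth None u i)).1.
Proof. by rewrite /state_at mkseqS foldl_rcons. Qed.

Lemma mkseq_nthS (u : seq (option P)) i :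
  mkseq (nth None u) i.+1 = head None u :: mkseq (nth None (behead u)) i.
Proof.
rewrite /mkseq /= (iotaDl 1 0) -map_comp nth0; congr (_ :: _).
by apply: eq_map => j /=; rewrite nth_behead.
Qed.

Lemma state_at_default q u i : (forall k, (tz k None).1 = k) -> (size u <= i)%N ->
  state_at q u i = foldl (fun k y => (tz k y).1) q u.
Proof.
move=> e; elim: i u q => [|i IH] [|y u] q //.
  by rewrite /state_at mkseq_nthS /= e => _; exact: (IH [::]).
by move=> le_i; rewrite /state_at mkseq_nthS /=; exact: IH.
Qed.
End Transducers.

Section Rewriting.
Variables (S P : Type) (tz : S -> option P -> S * option P).

Definition rewrites q u u' : Prop :=
  forall i, (tz (state_at tz q u i) (nth None u i)).2 = nth None u' i.

Lemma rewrites_head q q' u x' u' : tz q (head None u) = (q', x') ->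
  rewrites q' (behead u) u' -> rewrites q u (x' :: u').
Proof.
move=> e R [|i]; first by rewrite /state_at /= nth0 e.
by rewrite /state_at mkseq_nthS /= e -nth_behead; exact: R.
Qed.

Lemma rewrites_id q u : (forall x, tz q x = (q, x)) -> rewrites q u u.
Proof.
move=> e i; suff -> : state_at tz q u i = q by rewrite e.
by elim: i => // i IH; rewrite state_atS IH e.
Qed.

End Rewriting.

Section Counters.
Variable A : finType.
Local Notation Sig := (sym A).
Local Notation track w := [seq Some s | s <- w].

Lemma rewrites_settled (u : seq (option Sig)) : rewrites (@counter_step A) Settled u u.
Proof. exact: rewrites_id. Qed.

Lemma rewrites_insert (p : Sig) w :
  rewrites (@counter_step A) (Insert p) (track w) (track (p :: w)).
Proof.
elim: w p => [|s w IH] p; apply: (rewrites_head erefl); last exact: IH.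
exact: rewrites_settled.
Qed.

(** When the carry leaves the numeral it meets [ssep]: the new top bit takes that cell and the
    insertion moves the rest. *)
Lemma rewrites_carry_num b w :
  rewrites (@counter_step A) CarryNum (track (enc_bits b ++ ssep :: w))
    (track (enc_bits (bsucc b) ++ ssep :: w)).
Proof.
elim: b => [|[] b IH]; apply: (rewrites_head erefl).
- exact: rewrites_insert.
- exact: IH.
- exact: rewrites_settled.
Qed.

Lemma rewrites_num h t :
  rewrites (@counter_step A) Sign (track (enc_frac (Posz h) t))
    (track (enc_frac (Posz h.+1) t)).
Proof.
rewrite /enc_frac /enc_int /enc_nat bin_succ.
apply: (rewrites_head erefl); exact: rewrites_carry_num.
Qed.

Lemma rewrites_carry_den b :
  rewrites (@counter_step A) CarryDen (track (enc_bits b)) (track (enc_bits (bsucc b))).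
Proof.
elim: b => [|[] b IH]; apply: (rewrites_head erefl).
- exact: rewrites_settled.
- exact: IH.
- exact: rewrites_settled.
Qed.

Lemma rewrites_skip_num b c :
  rewrites (@counter_step A) SkipNum (track (enc_bits b ++ ssep :: enc_bits c))
    (track (enc_bits b ++ ssep :: enc_bits (bsucc c))).
Proof.
elim: b => [|[] b IH]; apply: (rewrites_head erefl); first exact: rewrites_carry_den.
- exact: IH.
- exact: IH.
Qed.

Lemma rewrites_den h t :
  rewrites (@counter_step A) SkipNum (track (enc_frac (Posz h) t))
    (track (enc_frac (Posz h) t.+1)).
Proof.
rewrite /enc_frac /enc_int /enc_nat bin_succ.
apply: (rewrites_head erefl); exact: rewrites_skip_num.
Qed.

Lemma size_enc_frac h t :
  size (@enc_frac A (Posz h) t) = (size (bin h) + size (bin t)).+2.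
Proof. by rewrite /enc_frac size_cat /= !size_map addnS. Qed.
End Counters.

(** The number of increments before an overflow: a digit multiplies what lies beyond it by the
    radix, whereas an unset mark adds one. *)
Fixpoint runs_left (o : seq (option digit)) : nat :=
  match o with
  | [::] => 0
  | None :: o' => runs_left o'
  | Some (inl v) :: o' => (radix - v.+1) + radix * runs_left o'
  | Some (inr b) :: o' => (~~ b) + runs_left o'
  end.

Definition odo_next (b : bool) (o : seq (option digit)) : seq (option digit) :=
  mkseq (fun i => (odo_step (state_at odo_step b o i) (nth None o i)).2) (size o).

Lemma rewrites_odo b o : rewrites odo_step b o (odo_next b o).
Proof.
move=> i; have [i_lt|i_ge] := ltnP i (size o); first by rewrite nth_mkseq.
rewrite [RHS]nth_default ?size_mkseq // nth_default //.
by case: (state_at _ _ _ _).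
Qed.

Lemma odo_next_cons b x o :
  odo_next b (x :: o) = (odo_step b x).2 :: odo_next (odo_step b x).1 o.
Proof.
rewrite /odo_next /mkseq /= (iotaDl 1 0) -map_comp; congr (_ :: _).
by apply: eq_map => i /=; rewrite {1}/state_at mkseq_nthS.
Qed.

Lemma odo_next_false o : odo_next false o = o.
Proof. by elim: o => // x o IH; rewrite odo_next_cons /= IH. Qed.

Definition odo_carry b o := foldl (fun k y => (odo_step k y).1) b o.

Lemma odo_carry_false o : odo_carry false o = false.
Proof. by elim: o. Qed.

Lemma odo_carryE o : odo_carry true o = (runs_left o == 0%N).
Proof.
elim: o => [|[[v|[]]|] o IH] //=; rewrite ?IH ?odo_carry_false //.
rewrite /odo_carry /=; case: insubP => [v' lt_v _|ge_v] /=.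
  by rewrite -/(odo_carry false o) odo_carry_false addn_eq0 subn_eq0 leqNgt lt_v.
rewrite -/(odo_carry true o) IH.
by rewrite addn_eq0 muln_eq0 subn_eq0 leqNgt (negPf ge_v).
Qed.

Lemma runs_left_next o : (0 < runs_left o)%N ->
  runs_left (odo_next true o) = (runs_left o).-1.
Proof.
elim: o => [|[[v|[]]|] o IH] //; rewrite odo_next_cons /= ?odo_next_false //.
case: insubP => [v' lt_v ev|ge_v] /=; rewrite ?odo_next_false ?ev.
  by move=> _; rewrite -subn_gt0 in lt_v; rewrite -[(radix - v.+1)%N](prednK lt_v) subnS.
have /eqP -> : (radix - v.+1 == 0)%N by rewrite subn_eq0 leqNgt.
rewrite add0n muln_gt0 /= => lt0; rewrite IH //.
by rewrite -[in RHS](prednK lt0) mulnS /radix; lia.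
Qed.

(** * One sweep of the estimator *)

Section Phases.
Variables (A : finType) (M : PTM (sym A)).
Local Notation Sig := (sym A).
Local Notation tape := (tsym M).
Local Notation E := (estimator M).
Local Notation track w := [seq Some s | s <- w].

Definition tracks (l r x : seq tape) (s : seq (option Sig)) (o : seq (option digit))
    (z : seq (option Sig)) (i : nat) : cell E :=
  (nth None l i, nth None r i, nth None x i, nth None s i, nth None o i, nth None z i).

Definition ready (q : bool -> fstate E) l r x s o z (st : sconfig E) : Prop :=
  holds q (tracks l r x s o z) st.

Definition simulating (q : state M) (b : bool) : fstate E :=
  if halting q then FCmp None else FSim q b.

Lemma tracks_blank n l r x s o z :
  (forall i, n <= i -> tracks l r x s o z i = blank)%N ->
  forall i, (n <= i)%N ->
  [/\ nth None l i = None, nth None r i = None & nth None x i = None] /\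
  [/\ nth None s i = None, nth None o i = None & nth None z i = None].
Proof. by move=> bl i /bl; rewrite /tracks => -[-> -> -> -> -> ->]. Qed.

Lemma eq_holds q c c' (st : sconfig E) : c =1 c' -> holds q c st -> holds q c' st.
Proof. by move=> cc' [g [w [? ? wc]]]; exists g, w; split=> // i; rewrite -cc'. Qed.

Lemma ready_stay q l u r x s o z st b : ~~ halting q ->
  (trans q u b).2 = Stay ->
  ready (simulating q) l (u :: r) x s o z st ->
  ready (simulating (trans q u b).1.1) l ((trans q u b).1.2 :: r) x s o z (sstep st b).
Proof.
move=> nh; case Et: (trans q u b) => [[q' g] mv] /= mvE H; rewrite {}mvE in Et.
apply: (holds_sstep (W := E) (c1 := tracks l (g :: r) x s o z) (h := fun=> BSim q')
  (f := fun i => if i is 0 then FSim q b else FKeep q') H) => //.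
- by rewrite /simulating (negPf nh).
- by case=> [|i] //=; rewrite Et.
- move=> n bl; split=> // -[|i] // n_lt.
  by have [[? ? ?] [? ? ?]] := tracks_blank bl (ltnW n_lt); congr (_, _, _, _, _, _).
Qed.

Lemma ready_right q l u r x s o z st b : ~~ halting q ->
  (trans q u b).2 = MoveR ->
  ready (simulating q) l (u :: r) x s o z st ->
  ready (simulating (trans q u b).1.1) ((trans q u b).1.2 :: l) r x s o z (sstep st b).
Proof.
move=> nh; case Et: (trans q u b) => [[q' g] mv] /= mvE H; rewrite {}mvE in Et.
apply: (holds_sstep (W := E) (c1 := tracks (g :: l) (u :: r) x s o z)
  (h := fun i => BPopR q' (nth None (u :: r) i))
  (f := fun i => if i is j.+1 then FPushL q' (nth None l j) else FSim q b) H) => //.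
- by rewrite /simulating (negPf nh).
- by case=> [|i] //=; rewrite Et.
- move=> n bl; split=> [|[|i] // n_lt].
    by have [[_ /= -> _] _] := tracks_blank bl (leqnSn n).
  have [[_ rn ?] [? ? ?]] := tracks_blank bl (ltnW n_lt).
  have [[? _ _] _] := tracks_blank bl n_lt.
  have [[_ rn' _] _] := tracks_blank bl (leqW (ltnW n_lt)).
  by congr (_, _, _, _, _, _).
Qed.

(* A blank input track would allow an empty tape, with no room for two symbols. *)
Lemma ready_left q l u r x s o z st b : head None x != None -> ~~ halting q ->
  (trans q u b).2 = MoveL ->
  ready (simulating q) l (u :: r) x s o z st ->
  ready (simulating (trans q u b).1.1) (behead l)
    (nth None l 0 :: (trans q u b).1.2 :: r) x s o z (sstep st b).
Proof.
move=> x0 nh; case Et: (trans q u b) => [[q' g] mv] /= mvE H; rewrite {}mvE in Et.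
apply: (holds_sstep (W := E) (c1 := tracks l (nth None l 0 :: g :: r) x s o z)
  (h := fun i => BPopL q' (nth None l i))
  (f := fun i => if i is j.+1 then FPushR q' (nth None (g :: r) j) else FSim q b) H) => //.
- by rewrite /simulating (negPf nh).
- by case=> [|[|i]] //=; rewrite Et.
- move=> n bl; split=> [|[//|i] n_lt].
    by have [[-> _ _] _] := tracks_blank bl (leqnSn n).
  have [[? ? ?] [? ? ?]] := tracks_blank bl (ltnW n_lt).
  have [[? _ _] _] := tracks_blank bl (leqW (ltnW n_lt)).
  rewrite ltnS in n_lt; have [[_ ri _] _] := tracks_blank bl n_lt.
  congr (_, _, _, _, _, _); rewrite ?nth_behead //.
  case: (i) n_lt ri => [|j] //; rewrite leqn0 => /eqP n0.
  by have [[_ _ xi] _] := tracks_blank bl (eq_leq n0); rewrite nth0 in xi; rewrite xi in x0.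
- by move=> i; rewrite /= /tracks nth_behead.
Qed.

Lemma ready_step c x s o z st b : head None x != None -> ~~ halting (cstate c) ->
  ready (simulating (cstate c)) (cleft c) (ccur c :: cright c) x s o z st ->
  let c' := step c b in
  ready (simulating (cstate c')) (cleft c') (ccur c' :: cright c') x s o z (sstep st b).
Proof.
case: c => q l u r /= x0 nh H; rewrite /step /= (negPf nh).
have stay e := ready_stay (b := b) nh e H.
have right e := ready_right (b := b) nh e H.
have left e := ready_left (b := b) x0 nh e H.
case Et: (trans q u b) stay right left => [[q' g] []] /= stay right left.
- by move: (left erefl); clear; case: l => [|v l] H; exact: H.
- move: (right erefl); clear; case: r => [|v r] H; last exact: H.
  (* At the right end the machine stores an explicit blank, while the track is empty; both read the
     same through [nth None]. *)
  by apply: eq_holds H => -[|i]; rewrite /tracks /= ?nth_nil.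
- exact: stay.
Qed.

Lemma ready_load l r x s o z st b : head None s != Some ssep ->
  ready (fun=> FShift) l r x s o z st ->
  ready (simulating (start M)) [::] x x s o z (sstep st b).
Proof.
move=> s0 H.
apply: (holds_sstep (W := E) (c1 := tracks [::] x x s o z)
  (h := fun=> BSim (start M))
  (f := fun i => if i is j.+1 then FLoad else FShift) H) => //.
- by case=> [|i] //=; rewrite ?nth0 ?(negPf s0) /tracks /= ?nth_nil ?nth0.
- move=> n bl; split=> // i n_lt.
  have [[? ? ?] [? ? ?]] := tracks_blank bl (ltnW n_lt).
  by congr (_, _, _, _, _, _); rewrite ?nth_nil.
Qed.

(** The condition on [z] covers the blank estimate track of the first shift and the fraction 0/0
    found by later ones. Every shift rewrites this fraction, so the counters need no sweep of their
    own to start. *)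
Lemma ready_shift l r x s o z st b : behead (behead z) = [::] ->
  ready (fun=> FShift) l r x (Some ssep :: s) o z st ->
  ready (fun=> FShift) l r x s o (track (enc_frac 0 0)) (sstep st b).
Proof.
move=> z2 H.
have zi i : (1 < i)%N -> nth None z i = None.
  by case: i => [|[|i]] // _; rewrite -!nth_behead z2 nth_nil.
apply: (holds_sstep (W := E)
  (c1 := tracks l r x (Some ssep :: s) o (track (enc_frac 0 0)))
  (h := fun i => BPopS (nth None (Some ssep :: s) i))
  (f := fun i => match i with 0 => FShift | 1 => FShift1 | _ => FShift2 end) H) => //.
- by case=> [|[|i]] //=; rewrite /tracks zi //= nth_nil.
- move=> n bl; split=> [|[//|[|i]] n_lt].
    by have [_ [/= -> _ _]] := tracks_blank bl (leqnSn n); case: n {bl}.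
    by have := bl 0; rewrite -ltnS n_lt => /(_ isT).
  have [[? ? ?] [_ ? _]] := tracks_blank bl (ltnW n_lt).
  have [_ [/= ? _ _]] := tracks_blank bl (leqW (ltnW n_lt)).
  by congr (_, _, _, _, _, _) => //; rewrite /= nth_nil.
Qed.

Definition bit_matches (p t : Sig) : bool :=
  if p == sdot then (t == s0) || (t == s1) else t == p.

Fixpoint matches (s : seq Sig) (r : seq tape) : bool :=
  match s, r with
  | [::], Some (inl _) :: _ => false
  | [::], _ => true
  | p :: s', Some (inl t) :: r' => bit_matches p t && matches s' r'
  | _ :: _, _ => false
  end.

Definition verdict r s i : option bool :=
  foldl (fun v (c : tape * option Sig) => cmp_step v c.1 c.2) None
    (mkseq (fun i => (nth None r i, nth None s i)) i).

Lemma verdictS r s i :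
  verdict r s i.+1 = cmp_step (verdict r s i) (nth None r i) (nth None s i).
Proof. by rewrite /verdict mkseqS foldl_rcons. Qed.

(** The cell just past the pattern settles the comparison at the latest, because the output has to
    end there too. *)
Lemma verdict_matches r s i : (size s < i)%N ->
  verdict r (track s) i = Some (matches s r).
Proof.
have decided v c : foldl (fun v (c : tape * option Sig) => cmp_step v c.1 c.2)
  (Some v) c = Some v by elim: c.
have front r' s' j : mkseq (fun i => (nth (None : tape) r' i, nth (None : option Sig) s' i)) j.+1 =
    (head None r', head None s') ::
      mkseq (fun i => (nth (None : tape) (behead r') i, nth (None : option Sig) (behead s') i)) j.
  rewrite /mkseq /= (iotaDl 1 0) -map_comp !nth0; congr (_ :: _).
  by apply: eq_map => k /=; rewrite !nth_behead.
elim: s r i => [|p s IH] r [|i] // s_lt; rewrite /verdict front.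
  by case: r => [|[[t|t]|] r]; rewrite /= decided.
case: r => [|[[t|t]|] r]; rewrite /= ?decided //.
rewrite -/(bit_matches p t); case: (bit_matches p t); last by rewrite decided.
exact: IH.
Qed.

Lemma size_track n (w : seq Sig) :
  (forall i, (n <= i)%N -> nth None (track w) i = None) -> (size w <= n)%N.
Proof.
move=> bl; rewrite leqNgt; apply/negP => n_lt.
by have := bl n (leqnn n); rewrite (nth_map ssep).
Qed.

Lemma ready_compare q l r x s o z st b : halting q ->
  ready (simulating q) l r x (track s) o z st ->
  ready (fun=> if matches s r then FInc Sign else FCount SkipNum true)
    l r x (track s) o z (sstep st b).
Proof.
move=> hq H.
have [||||g [w [-> gq wc]]] := @holds_sstep _ E _ b _ (tracks l r x (track s) o z) 
  (tracks l r x (track s) o z) (fun i => FCmp (verdict r (track s) i))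
  (fun=> if matches s r then BInc else BCount) _ H.
- by rewrite /simulating hq.
- by move=> i; rewrite verdictS.
- move=> n bl; split=> [|i n_lt]; last exact: bl (ltnW n_lt).
  rewrite verdict_matches; first by case: (matches s r).
  rewrite ltnS; apply: size_track => i /(tracks_blank bl).
  by case=> _ [].
- by move=> i; case: (matches s r).
by exists g, w; split=> // b'; rewrite gq; case: (matches s r).
Qed.

Lemma ready_increment l r x s o h t st b :
  ready (fun=> FInc Sign) l r x s o (track (enc_frac (Posz h) t)) st ->
  ready (fun=> FCount SkipNum true) l r x s o (track (enc_frac (Posz h.+1) t)) (sstep st b).
Proof.
move=> H.
apply: (holds_sstep (W := E)
  (c1 := tracks l r x s o (track (enc_frac (Posz h.+1) t))) (h := fun=> BCount)
  (f := fun i => FInc (state_at (@counter_step A) Sign (track (enc_frac (Posz h) t)) i)) H) => //.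
- move=> i; rewrite /= state_atS /tracks -(rewrites_num _ h t i).
  by case: (counter_step _ _).
- move=> n bl; split=> // i n_lt.
  have [[? ? ?] [? ? _]] := tracks_blank bl (ltnW n_lt).
  congr (_, _, _, _, _, _) => //; apply: nth_default; apply: leq_trans n_lt.
  have le_n : (size (@enc_frac A (Posz h) t) <= n)%N.
    by apply: size_track => j /(tracks_blank bl) [_ []].
  have := size_bsucc (bin h); move: le_n; rewrite size_map !size_enc_frac bin_succ; lia.
Qed.

Lemma tracks_count_blank l r x s o h t (n : nat) :
  (forall i, n <= i -> tracks l r x s o (track (enc_frac (Posz h) t)) i = blank)%N ->
  forall i, (n < i)%N ->
  tracks l r x s (odo_next true o) (track (enc_frac (Posz h) t.+1)) i = blank.
Proof.
move=> bl i n_lt.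
have [[? ? ?] [? oi _]] := tracks_blank bl (ltnW n_lt).
congr (_, _, _, _, _, _) => //.
  by rewrite -rewrites_odo oi; case: (state_at _ _ _ _).
apply: nth_default; apply: leq_trans n_lt.
have le_n : (size (@enc_frac A (Posz h) t) <= n)%N.
  by apply: size_track => j /(tracks_blank bl) [_ []].
have := size_bsucc (bin t); move: le_n; rewrite size_map !size_enc_frac bin_succ; lia.
Qed.

Definition counting_state h t o i : fstate E :=
  FCount (state_at (@counter_step A) SkipNum (track (enc_frac (Posz h) t)) i)
         (state_at odo_step true o i).

Lemma counting_stateS l r x s o h t i :
  fwd (counting_state h t o i) (tracks l r x s o (track (enc_frac (Posz h) t)) i) =
  (counting_state h t o i.+1,
   tracks l r x s (odo_next true o) (track (enc_frac (Posz h) t.+1)) i).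
Proof.
rewrite /counting_state !state_atS /tracks -(rewrites_den _ h t i) -rewrites_odo /=.
by case: (counter_step _ _); case: (odo_step _ _).
Qed.

Lemma state_at_odo n l r x s o z :
  (forall i, n <= i -> tracks l r x s o z i = blank)%N ->
  state_at odo_step true o n = (runs_left o == 0%N).
Proof.
move=> bl; rewrite -odo_carryE.
have on i : (n <= i)%N -> nth None o i = None by case/(tracks_blank bl) => _ [].
rewrite /odo_carry -(@state_at_default _ _ _ odo_step true o (n + size o)) ?leq_addl //; last by case.
elim: (size o) => [|k IH]; rewrite ?addn0 //.
by rewrite addnS state_atS on ?leq_addr // -IH; case: (state_at _ _ _ _).
Qed.

Lemma ready_count l r x s o h t st b : (0 < runs_left o)%N ->
  ready (fun=> FCount SkipNum true) l r x s o (track (enc_frac (Posz h) t)) st ->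
  ready (fun=> FShift) l r x s (odo_next true o) (track (enc_frac (Posz h) t.+1))
    (sstep st b).
Proof.
move=> o_gt0 H.
apply: (holds_sstep (W := E) (h := fun=> BShift) (f := counting_state h t o) H) => //.
- exact: counting_stateS.
- move=> n bl; split; last exact: tracks_count_blank bl.
  rewrite /= (state_at_odo (n := n.+1) (fun i ni => bl i (ltnW ni))).
  by rewrite gtn_eqF.
- by [].
Qed.

(** The overflowing sweep still increments the denominator, so the last run is counted. *)
Lemma ready_answer l r x s o h t st b (R : realFieldType) (F : seq Sig -> R) :
  runs_left o = 0%N ->
  ready (fun=> FCount SkipNum true) l r x s o (track (enc_frac (Posz h) t)) st ->
  shalt (sstep st b) /\ sanswer F (sstep st b) = F (enc_frac (Posz h) t.+1).
Proof.
move=> o0 H.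
have [|||w -> wc] := @halts_sstep _ E _ b _
  (tracks l r x s (odo_next true o) (track (enc_frac (Posz h) t.+1)))
  (counting_state h t o) _ H.
- by [].
- exact: counting_stateS.
- move=> n bl; split; last exact: tracks_count_blank bl.
  by rewrite /= (state_at_odo (n := n.+1) (fun i ni => bl i (ltnW ni))) o0.
split=> //=; congr (F _); apply: out_word_nth => i.
rewrite /shown.
have -> : nth None [seq omap inl (display c) | c <- w] i =
  omap inl (display (nth (blank : cell E) w i)) :> tsym (sweep_ptm E).
  have [lt_i|ge_i] := ltnP i (size w); first by rewrite (nth_map blank).
  by rewrite !nth_default ?size_map.
rewrite wc {wc}; move: (enc_frac _ _) => u; rewrite /=.
have [lt_i|ge_i] := ltnP i (size u); first by rewrite !(nth_map ssep) //.
by rewrite !nth_default ?size_map.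
Qed.
End Phases.

(** * Runs of the estimator *)

Section Initialisation.
Variables (A : finType) (M : PTM (sym A)).
Local Notation Sig := (sym A).
Local Notation tape := (tsym M).
Local Notation E := (estimator M).
Local Notation track w := [seq Some s | s <- w].

Definition emits k (u : seq Sig) (x : seq tape) (s : seq (option Sig))
    (o : seq (option digit)) : Prop :=
  forall i, (init_step M (state_at (@init_step A M) k (track u) i) (nth None (track u) i)).2
    = (nth None x i, nth None s i, nth None o i).

Lemma emits_head k k' p u x s o :
  init_step M k (Some p) = (k', (head None x, head None s, head None o)) ->
  emits k' u (behead x) (behead s) (behead o) -> emits k (p :: u) x s o.
Proof.
move=> e R [|i]; first by rewrite /state_at /= e -!nth0.
by rewrite /state_at mkseq_nthS /= e -!nth_behead; exact: R.
Qed.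

Lemma emits_pattern u : emits (Some None) u [::] (track u) [::].
Proof.
move=> i; suff -> : state_at (@init_step A M) (Some None) (track u) i = Some None.
  by rewrite !nth_nil.
by elim: i => // i IH; rewrite state_atS IH.
Qed.

Lemma emits_confidence b u :
  emits (Some (Some true)) (enc_bits b ++ ssep :: u) [::]
    (nseq (size b).+1 (Some ssep) ++ track u) (nseq (size b) (Some (inr false))).
Proof.
elim: b => [|[] b IH].
- by apply: (emits_head (k' := Some None)); last exact: emits_pattern.
- by apply: (emits_head (k' := Some (Some true))); last exact: IH.
- by apply: (emits_head (k' := Some (Some true))); last exact: IH.
Qed.

Lemma emits_precision b c u :
  emits (Some (Some false)) (enc_bits b ++ ssep :: enc_bits c ++ ssep :: u)
    [seq Some (inl s) | s <- enc_bits (rcons b true)]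
    (nseq (size b + (size c).+1).+1 (Some ssep) ++ track u)
    (nseq (size b) (Some (inl ord0)) ++ None :: nseq (size c) (Some (inr false))).
Proof.
elim: b => [|[] b IH].
- by apply: (emits_head (k' := Some (Some true))); last exact: emits_confidence.
- by apply: (emits_head (k' := Some (Some false))); last exact: IH.
- by apply: (emits_head (k' := Some (Some false))); last exact: IH.
Qed.

(** The pattern track is filled with [ssep] up to the third separator; the length of this prefix is
    the number of shifts that align S. Digits lie below the bits of m, marks below those of d. *)
Lemma emits_input a b c u :
  emits None (map (@sA A) a ++ ssep :: enc_bits b ++ ssep :: enc_bits c ++ ssep :: u)
    [seq Some (inl s) | s <- map (@sA A) a ++ ssep :: enc_bits (rcons b true)]
    (nseq (size a + (size b + (size c).+1).+1).+1 (Some ssep) ++ track u)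
    (nseq (size a).+1 None ++
      nseq (size b) (Some (inl ord0)) ++ None :: nseq (size c) (Some (inr false))).
Proof.
elim: a => [|y a IH].
- by apply: (emits_head (k' := Some (Some false))); last exact: emits_precision.
- by apply: (emits_head (k' := None)); last exact: IH.
Qed.

(** The [n] marks give [n.+1] cycles of the digits, and the successor accounts for the run on which
    the odometer overflows. *)
Lemma runs_left_init k l n :
  (runs_left (nseq k None ++ nseq l (Some (inl ord0)) ++ None :: nseq n (Some (inr false)))).+1
  = (radix ^ l * n.+1)%N.
Proof.
elim: k => [|k] //; elim: l => [|l IH] /=.
  by rewrite mul1n; congr _.+1; elim: n => //= n ->.
by move: IH; rewrite /= expnS -mulnA => <-; move: (runs_left _) => y; rewrite /radix; lia.
Qed.

Lemma ready_init u x s o : emits None u x s o ->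
  (size x <= size u)%N -> (size s <= size u)%N -> (size o <= size u)%N ->
  ready (fun=> FShift) [::] [::] x s o [::] (finish (finit : fstate E) (map decode u)).
Proof.
move=> em x_le s_le o_le.
apply: (holds_finish (W := E) (c := tracks [::] [::] [::] (track u) [::] [::])
  (c1 := tracks [::] [::] x s o [::]) (h := fun=> BShift)
  (f := fun i => FInit (state_at (@init_step A M) None (track u) i))) => //.
- move=> i; rewrite /tracks !nth_nil.
  have [lt_i|ge_i] := ltnP i (size u); first by rewrite !(nth_map ssep).
  by rewrite !nth_default ?size_map.
- move=> i; rewrite /= state_atS; have := em i.
  by case: (init_step _ _ _) => k [[x' s'] o'] /= [-> -> ->].
- rewrite size_map => i lt_i; rewrite /tracks !nth_nil.
  by rewrite !nth_default // (leq_trans _ (ltnW lt_i)).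
Qed.

Variables (R : realFieldType) (F : seq Sig -> R).
Local Notation bound := (bounded (@sstep _ E) (@shalt _ E) (@sanswer _ E R F)).

Lemma bounded_shift k n l r x w o z st v :
  behead (behead z) = [::] ->
  (forall st', ready (fun=> FShift) l r x w o (track (enc_frac 0 0)) st' -> bound n st' v) ->
  ready (fun=> FShift) l r x (nseq k.+1 (Some ssep) ++ w) o z st ->
  bound (k.+1 + n) st v.
Proof.
move=> + B; elim: k z st => [|k IH] z st z2 H; rewrite addSn; apply: bounded_next => b.
  by apply: B; apply: ready_shift H.
by apply: IH (ready_shift b z2 H).
Qed.

(** * The loop over the runs *)

Section MainLoop.
Variables (w pat : seq Sig) (T N : nat) (p : R) (V : nat -> nat -> R).
Hypotheses (w_neq0 : w != [::]) (pat_start : head None (track pat) != Some ssep).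
Hypothesis halts : halts_within M w T.

Definition accepts (c : config M) : bool := matches pat (ccur c :: cright c).

Hypothesis pE : p = expect (@step _ M) (fun c => (accepts c)%:R) T (init_config M w).
Hypothesis V0 : forall h, F (enc_frac (Posz h) N) <= V 0 h.
Hypothesis VS : forall j h, p * V j h.+1 + (1 - p) * V j h <= V j.+1 h.

Local Notation X := ([seq Some (inl s) | s <- w] : seq tape).

(** The premise holds for whatever stacks the run leaves behind, so the rest depends on this run
    only through hit or miss. The three extra sweeps load the input, compare, and increment after a
    hit. *)
Lemma bounded_run n v0 v1 l r o h t st :
  (forall (b : bool) l' r' st',
     ready (fun=> FCount SkipNum true) l' r' X (track pat) o
       (track (enc_frac (Posz (b + h)%N) t)) st' ->
     bound n st' (if b then v1 else v0)) ->
  ready (fun=> FShift) l r X (track pat) o (track (enc_frac (Posz h) t)) st ->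
  bound (T + n.+3) st (p * v1 + (1 - p) * v0).
Proof.
move=> B H; rewrite addnS; apply: bounded_next => b.
have {H} := ready_load b pat_start H.
move: (sstep st b) => {}st {b} H.
pose W c : R := if accepts c then v1 else v0.
(* [W] is affine in the indicator of acceptance, whose mean is [p]. *)
have -> : p * v1 + (1 - p) * v0 = expect (@step _ M) W T (init_config M w).
  rewrite (@eq_expect _ _ _ W (fun c => (v1 - v0) * (accepts c)%:R + v0)); last first.
    by move=> c; rewrite /W; case: (accepts c); rewrite ?mulr1 ?mulr0 ?add0r ?subrK.
  by rewrite expectD expectZ expect_const -pE; ring.
pose emb (c : config M) st' :=
  ready (simulating (cstate c)) (cleft c) (ccur c :: cright c) X (track pat) o
    (track (enc_frac (Posz h) t)) st'.
have {H} : emb (init_config M w) st.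
  by rewrite /emb; move: H; case: (w) w_neq0.
apply: (@bounded_simulation R _ (@step _ M) (fun c => halting (cstate c)) _ _ emb W
  (fun k d v => bound k d v)) => //.
- exact: step_halting.
- by move=> k d v v' Bk le_v; apply: bounded_le Bk _ le_v.
- move=> k c d nh cd u0 u1 B0 B1.
  have X0 : head None X != None by case: (w) w_neq0.
  apply: BoundedStep (lexx _); [apply: B0|apply: B1]; exact: ready_step.
- move=> c d hc cd; apply: bounded_next => b.
  have := ready_compare b hc cd; rewrite /W /accepts.
  case: (matches _ _) => H.
    apply: bounded_next => b'; apply: (B true); exact: ready_increment H.
  by apply: bounded_le (B false _ _ _ H) _ (lexx _).
- move=> q sq; exact: (halts (Tuple (introT eqP sq))).
Qed.

(** [V] is indexed by the runs still to come, one more than [runs_left] because of the overflowing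
    run. A run takes [T + 3] sweeps and a fourth extra one to count it. *)
Lemma bounded_loop j h t o l r st : runs_left o = j -> (t + j.+1 = N)%N ->
  ready (fun=> FShift) l r X (track pat) o (track (enc_frac (Posz h) t)) st ->
  bound (j.+1 * (T + 4)) st (V j.+1 h).
Proof.
elim: j h t o l r st => [|j IH] h t o l r st oj tN H.
  apply: bounded_le (bounded_run (n := 1) (v0 := V 0 h) (v1 := V 0 h.+1) _ H) _ (VS _ _).
    move=> b l' r' st' H'; apply: bounded_next => b'.
    have [? e] := ready_answer b' F oj H'.
    apply: BoundedHalt => //; rewrite e; move: tN; rewrite addn1 => ->.
    by case: b {H' e}; exact: V0.
  by rewrite mul1n.
apply: bounded_le (bounded_run (n := (j.+1 * (T + 4)).+1)
  (v0 := V j.+1 h) (v1 := V j.+1 h.+1) _ H) _ (VS _ _); last by lia.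
move=> b l' r' st' H'; apply: bounded_next => b'.
have o_gt0 : (0 < runs_left o)%N by rewrite oj.
have H2 := ready_count b' o_gt0 H'.
have oj' : runs_left (odo_next true o) = j by rewrite runs_left_next // oj.
have tN' : (t.+1 + j.+1 = N)%N by rewrite -tN; lia.
by have := IH _ _ _ _ _ _ oj' tN' H2; case: (b).
Qed.
End MainLoop.

Lemma bounded_estimator a b c pat T p V :
  let x := map (@sA A) a ++ ssep :: enc_bits b ++ ssep :: enc_bits c ++ ssep :: pat in
  let w := map (@sA A) a ++ ssep :: enc_bits (rcons b true) in
  let N := (radix ^ size b * (size c).+1)%N in
  let n := (size x + N * (T + 4))%N in
  head None (track pat) != Some ssep -> halts_within M w T ->
  p = expect (@step _ M) (fun c => (accepts pat c)%:R) T (init_config M w) ->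
  (forall h, F (enc_frac (Posz h) N) <= V 0 h) ->
  (forall j h, p * V j h.+1 + (1 - p) * V j h <= V j.+1 h) ->
  bounded (@step _ (sweep_ptm E)) (fun d => halting (cstate d)) (fun d => F (output d))
    (n.+1 * ((size x + n.+1).*2 + 4)) (init_config (sweep_ptm E) x) (V N 0).
Proof.
move=> x w N n pat_start halts pE V0 VS; apply: bounded_from_init.
have := ready_init (emits_input a b c pat).
have xE : size x = ((size a + (size b + (size c).+1).+1).+1 + size pat)%N.
  by rewrite /x /enc_bits; do ?[rewrite !(size_cat, size_map) /=]; lia.
have N_gt0 : (0 < N)%N by rewrite /N muln_gt0 expn_gt0.
case=> [|||g H].
- by rewrite -/x xE !size_map size_cat /= !size_map size_rcons; lia.
- by rewrite -/x xE size_cat /= size_nseq size_map; lia.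
- by rewrite -/x xE size_cat /= !size_cat /= !size_nseq; lia.
have {}H : ready (fun=> FShift) [::] [::] [seq Some (inl s) | s <- w]
   (nseq (size a + (size b + (size c).+1).+1).+1 (Some ssep) ++ track pat)
   (nseq (size a).+1 None ++
      nseq (size b) (Some (inl ord0)) ++ None :: nseq (size c) (Some (inr false)))
   [::] (finish (finit : fstate E) (map decode x)) by exists g.
apply: bounded_le (bounded_shift (n := N * (T + 4)) _ _ H) _ (lexx _) => //; last first.
  by rewrite leq_add2r xE; lia.
have rl := runs_left_init (size a).+1 (size b) (size c); rewrite -/N in rl.
move=> st' H'; rewrite -rl.
apply: (bounded_loop _ pat_start halts pE V0 VS (h := 0) (t := 0) erefl _ H').
  by rewrite /w; case: (a).
by rewrite rl.
Qed.
End Initialisation.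

(** * A Chernoff bound *)

Section TailBound.
Variable R : realType.

(** Since exp(-x) >= 1 - x, it suffices that (1 - x)(1 + x + 2x^2) = 1 + x^2 (1 - 2x) is at least 1,
    which is where x <= 1/2 enters. *)
Lemma expR_le_quadratic (x : R) : - 2^-1 <= x <= 2^-1 -> expR x <= 1 + x + 2 * x ^+ 2.
Proof.
case/andP=> x_ge x_le; have := expR_ge1Dx (- x); rewrite expRN => le_inv.
have pos := expR_gt0 x.
have le1 : (1 - x) * expR x <= 1 by rewrite -ler_pdivlMr // mul1r.
have sq : 1 <= (1 - x) * (1 + x + 2 * x ^+ 2) by have := sqr_ge0 x; nra.
have x1 : 0 < 1 - x by lra.
by rewrite -(ler_pM2l x1); apply: le_trans sq.
Qed.

(** The variable is centred, so the linear terms of the two quadratic bounds cancel; the quadratic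
    ones add up to 2 s^2 p(1 - p). *)
Lemma bernoulli_mgf (p s : R) : 0 <= p <= 1 -> - 2^-1 <= s <= 2^-1 ->
  p * expR (s * (1 - p)) + (1 - p) * expR (- (s * p)) <= expR (2 * s ^+ 2).
Proof.
move=> /andP[p0 p1] /andP[s_ge s_le]; apply: le_trans (expR_ge1Dx _).
have e1 : expR (s * (1 - p)) <= 1 + s * (1 - p) + 2 * (s * (1 - p)) ^+ 2.
  by apply: expR_le_quadratic; apply/andP; split; nra.
have e2 : expR (- (s * p)) <= 1 - s * p + 2 * (- (s * p)) ^+ 2.
  by apply: expR_le_quadratic; apply/andP; split; nra.
have q0 : 0 <= 1 - p by lra.
apply: le_trans (lerD (ler_wpM2l p0 e1) (ler_wpM2l q0 e2)) _.
rewrite [leLHS](_ : _ = 1 + 2 * s ^+ 2 * (p * (1 - p))); last by ring.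
have pq : p * (1 - p) <= 1 by nra.
by rewrite lerD2l ler_piMr // mulr_ge0 ?sqr_ge0.
Qed.

(** With [j] runs to come, h + jp is the expected final hit count; the last summand pays the moment
    bound 2 s^2 of each of these runs. *)
Definition tail (s p : R) (N : nat) (t : R) (j h : nat) : R :=
  expR (s * (h%:R - N%:R * p + j%:R * p) - `|s| * N%:R * t + j%:R * (2 * s ^+ 2)).

Lemma tail_step (s p : R) N (t : R) j h : 0 <= p <= 1 -> - 2^-1 <= s <= 2^-1 ->
  p * tail s p N t j h.+1 + (1 - p) * tail s p N t j h <= tail s p N t j.+1 h.
Proof.
move=> p01 s12; rewrite /tail.
set a := s * (h%:R - N%:R * p + j%:R * p) - `|s| * N%:R * t + j%:R * (2 * s ^+ 2).
rewrite [X in p * expR X](_ : _ = (a + s * p) + s * (1 - p)); last first.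
  by rewrite -natr1 /a; ring.
rewrite [X in (1 - p) * expR X](_ : _ = (a + s * p) + - (s * p)); last by ring.
rewrite [X in _ <= expR X](_ : _ = (a + s * p) + 2 * s ^+ 2); last first.
  by rewrite -natr1 /a; ring.
rewrite !(expRD (a + _)) ![_ * (expR (a + _) * _)]mulrCA -mulrDr.
by rewrite ler_pM2l ?expR_gt0 //; exact: bernoulli_mgf.
Qed.

(* [s = t / 4] minimises the exponent [2 s^2 - s t] of both tails. *)
Definition deviation (p : R) (N : nat) (t : R) (j h : nat) : R :=
  tail (t / 4) p N t j h + tail (- (t / 4)) p N t j h.

Lemma deviation_step (p : R) N (t : R) j h : 0 <= p <= 1 -> 0 <= t <= 1 ->
  p * deviation p N t j h.+1 + (1 - p) * deviation p N t j h <= deviation p N t j.+1 h.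
Proof.
move=> p01 /andP[t0 t1]; rewrite /deviation !mulrDr addrACA.
by apply: lerD; apply: tail_step => //; apply/andP; split; lra.
Qed.

Lemma deviation_ge0 (p : R) N (t : R) j h : 0 <= deviation p N t j h.
Proof. by rewrite addr_ge0 ?expR_ge0. Qed.

(** The sign of p - h/N selects the tail whose exponent is nonnegative; the other tail is only used
    to be nonnegative. *)
Lemma deviation_ge1 (p : R) N (t : R) h : (0 < N)%N -> 0 <= t ->
  t <= `|p - h%:R / N%:R| -> 1 <= deviation p N t 0 h.
Proof.
move=> N_gt0 t0 far.
have N0 : 0 < N%:R :> R by rewrite ltr0n.
pose x : R := h%:R / N%:R; have hE : h%:R = N%:R * x by rewrite mulrC divfK ?gt_eqF.
have nt : `|t / 4| = t / 4 by rewrite ger0_norm //; lra.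
have ge1 (y : R) : 0 <= y -> 1 <= expR y by move=> y0; rewrite -expR0 ler_expR.
rewrite -/x in far; rewrite /deviation /tail normrN nt hE mulr0n.
case: (lerP p x) => [px|xp].
  rewrite -[leLHS]addr0; apply: lerD (expR_ge0 _); apply: ge1.
  rewrite distrC ger0_norm ?subr_ge0 // in far.
  rewrite [leRHS](_ : _ = t / 4 * N%:R * (x - p - t)); last by ring.
  by apply: mulr_ge0; [apply: mulr_ge0; lra|lra].
rewrite -[leLHS]add0r; apply: lerD (expR_ge0 _) _; apply: ge1.
rewrite ger0_norm in far; last by rewrite subr_ge0 ltW.
rewrite [leRHS](_ : _ = t / 4 * N%:R * (p - x - t)); last by ring.
by apply: mulr_ge0; [apply: mulr_ge0; lra|lra].
Qed.

Lemma deviation_start (p : R) N (t : R) : 0 <= t ->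
  deviation p N t N 0 = 2 * expR (- (N%:R * t ^+ 2 / 8)).
Proof.
move=> t0; have nt : `|t / 4| = t / 4 by rewrite ger0_norm //; lra.
by rewrite /deviation /tail normrN nt [RHS]mulr_natl [RHS]mulr2n mulr0n; congr (expR _ + expR _); field.
Qed.

(** Each tail is at most exp(-(L + 1)). As e >= 2, the two sum to at most 2^-L, which is at most
    1/d. *)
Lemma deviation_small (p : R) m d l L : (0 < m)%N -> (0 < d)%N -> (m < 2 ^ l)%N -> (d < 2 ^ L)%N ->
  deviation p (128 ^ l * L.+1) (m.*2%:R)^-1 (128 ^ l * L.+1) 0 <= (d%:R)^-1.
Proof.
move=> m0 d0 ml dL; rewrite deviation_start ?invr_ge0 //.
set N := (_ * _)%N.
have m0' : 0 < m%:R :> R by rewrite ltr0n.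
have d0' : 0 < d%:R :> R by rewrite ltr0n.
have N_ge : (32 * m ^ 2 * L.+1 <= N)%N.
  (* The case l = 0 contradicts m > 0. Otherwise 128^l = 32^l 4^l contains a factor 32, and m^2 <=
     4^l. *)
  rewrite /N leq_mul2r /=; case: l ml {N} => [|l] ml; first by case: (m) m0 ml.
  apply: leq_trans (_ : 32 * 4 ^ l.+1 <= _)%N.
    by rewrite leq_mul2l /= (_ : 4 = 2 ^ 2)%N // -expnM mulnC expnM leq_exp2r // ltnW.
  by rewrite !expnS mulnA (_ : 128 = 32 * 4)%N // expnMn; have := expn_gt0 32 l; have := expn_gt0 4 l; nia.
clearbody N; have le_exp : expR (- (N%:R * (m.*2%:R)^-1 ^+ 2 / 8)) <= expR (- L.+1%:R) :> R.
  rewrite ler_expR lerN2 -mul2n natrM invfM exprMn.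
  have : (32 * m ^ 2 * L.+1)%:R <= N%:R :> R by rewrite ler_nat.
  rewrite !natrM => le_N.
  rewrite (_ : _ / 8 = N%:R / (32 * (m%:R * m%:R))); last by field; rewrite gt_eqF.
  by rewrite ler_pdivlMr ?mulr_gt0 // mulrC.
apply: le_trans (ler_wpM2l _ le_exp) _ => //.
rewrite expRN -[L.+1%:R]mulr_natl mulr1 -(mulr1 L.+1%:R) expRM_natl.
have e2 : 2 <= expR 1 :> R by have := expR_ge1Dx (1 : R); lra.
have pow : 2 ^+ L.+1 <= expR 1 ^+ L.+1 :> R by rewrite lerXn2r // nnegrE ?expR_ge0.
have dL' : d%:R <= 2 ^+ L :> R by rewrite -natrX ler_nat ltnW.
rewrite ler_pdivrMr ?exprn_gt0 ?expR_gt0 // ler_pdivlMl //.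
apply: le_trans _ pow; rewrite exprS; lra.
Qed.

End TailBound.

(** * Polynomial bounds and the reduction *)

Section Acceptance.
Variables (A : finType) (M : PTM (sym A)).

Definition fits (o : option bool) (b : bool) : bool := if o is Some b' then b == b' else true.

Lemma agreesE k (S : k.-tuple (option bool)) (x : k.-tuple bool) :
  agrees S x = all2 fits S x.
Proof.
rewrite /agrees all2E !size_tuple eqxx /=.
have nthE i : nth (None, false) (zip S x) i = (nth None S i, nth false x i).
  by rewrite nth_zip ?size_tuple.
apply/forallP/(all_nthP (None, false)); rewrite size_zip !size_tuple minnn => fit i.
  by move=> i_lt; have := fit (Ordinal i_lt); rewrite nthE !(tnth_nth None) !(tnth_nth false).
by have := fit i (ltn_ord i); rewrite nthE (tnth_nth None) (tnth_nth false).
Qed.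

Lemma enc_bits_inj : injective (@enc_bits A).
Proof. by apply: inj_map => -[] []. Qed.

Lemma matchesP s (r : seq (tsym M)) :
  reflect (exists2 y, all2 fits s y & out_word r = enc_bits y) (matches (enc_S s) r).
Proof.
elim: s r => [|o s IH] r /=.
  case: r => [|[[t|t]|] r] /=; constructor; try by exists [::].
  by case=> -[].
case: r => [|[[t|t]|] r] /=; try by constructor; case=> -[].
have tP : bit_matches (if o is Some b then sbit b else sdot) t <->
          exists2 b, fits o b & t = sbit b.
  rewrite /bit_matches; case: o => [b|] /=; last first.
    by split=> [/orP[] /eqP ->|[[] _ ->]]; [exists false|exists true|..].
  rewrite (_ : sbit b == sdot = false); last by case: b.
  by split=> [/eqP ->|[_ /eqP -> ->]]; [exists b|].
apply: (iffP andP) => [[/tP [b ob ->] /IH [y sy ry]]|[[|b y] //= /andP[ob sy] [tb ry]]].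
  by exists (b :: y); rewrite /= ?ob // ry.
by split; [apply/tP; exists b|apply/IH; exists y].
Qed.

(** [enc_bits] is injective, so at most one summand is nonzero. This makes the acceptance
    probability a sum of the output probabilities that the simulator controls. *)
Lemma acceptsE (R : realFieldType) k (S : k.-tuple (option bool)) (c : config M) :
  (accepts (enc_S S) c)%:R =
  \sum_(y : k.-tuple bool | agrees S y) (`[< output c = enc_bits y >])%:R :> R.
Proof.
rewrite /accepts /output; case: matchesP => [[y Sy ry]|no].
  have sy : size y == k by move: Sy; rewrite all2E size_tuple eq_sym => /andP[].
  rewrite (bigD1 (Tuple sy)) /=; last by rewrite agreesE.
  rewrite asboolT // big1 ?addr0 // => y' /andP[_ ne].
  rewrite asboolF // => ry'; have /enc_bits_inj eq_y := etrans (esym ry) ry'.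
  by case/eqP: ne; apply: val_inj.
rewrite big1 // => y agr; rewrite asboolF // => ry; apply: no.
by exists y; rewrite -?agreesE.
Qed.
End Acceptance.

(** * Polynomial time bounds *)

Lemma leq_expl e m n : (m <= n)%N -> (m ^ e <= n ^ e)%N.
Proof. by case: e => [|e] // le_mn; rewrite leq_exp2r. Qed.

(** This is the shape of the time bound in [poly_box] with all parameters merged into one; closure
    under sums and products then yields the exponent. *)
Definition poly_bounded (f : nat -> nat) : Prop :=
  exists c e : nat, forall s, (f s <= c * s.+1 ^ e)%N.

Lemma poly_bounded_const k : poly_bounded (fun=> k).
Proof. by exists k, 0 => s; rewrite expn0 muln1. Qed.

Lemma poly_bounded_id : poly_bounded id.
Proof. by exists 1%N, 1%N => s; rewrite expn1 mul1n. Qed.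

Lemma poly_bounded_add f g : poly_bounded f -> poly_bounded g -> poly_bounded (fun s => f s + g s)%N.
Proof.
move=> [c [e fc]] [c' [e' gc]]; exists (c + c')%N, (e + e')%N => s.
rewrite mulnDl; apply: leq_add.
  by apply: leq_trans (fc s) _; rewrite leq_mul2l leq_pexp2l ?orbT ?leq_addr.
by apply: leq_trans (gc s) _; rewrite leq_mul2l leq_pexp2l ?orbT ?leq_addl.
Qed.

Lemma poly_bounded_mul f g : poly_bounded f -> poly_bounded g -> poly_bounded (fun s => f s * g s)%N.
Proof.
move=> [c [e fc]] [c' [e' gc]]; exists (c * c')%N, (e + e')%N => s.
by rewrite expnD mulnACA leq_mul.
Qed.

Lemma poly_bounded_exp f e : poly_bounded f -> poly_bounded (fun s => f s ^ e)%N.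
Proof.
move=> pf; elim: e => [|e IH]; first exact: (poly_bounded_const 1).
have [c [k le_k]] := poly_bounded_mul pf IH.
by exists c, k => s; rewrite expnS.
Qed.

(* [s] stands for n + m + up_log 2 d.  The bounds used are |bin m| < 2m,       *)
(* |bin d| <= up_log 2 d + 1, 2^|bin m| <= 2m and m' <= 3m.                     *)
Definition run_bound (c0 e0 c e s : nat) : nat :=
  let len := (c0 * s.+1 ^ e0 + 3 * s + 5)%N in
  let cycles := (len + (2 * s) ^ 7 * (s + 2) * (c * (4 * s + 1) ^ e + 4))%N in
  ((cycles + 1) * (2 * (len + cycles + 1) + 4))%N.

Lemma poly_bounded_run_bound c0 e0 c e : poly_bounded (run_bound c0 e0 c e).
Proof.
have pS : poly_bounded S by exists 1%N, 1%N => s; rewrite expn1 mul1n.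
have C := poly_bounded_const; have I := poly_bounded_id.
have D := poly_bounded_add; have X := poly_bounded_mul; have P := poly_bounded_exp.
have len : poly_bounded (fun s => c0 * s.+1 ^ e0 + 3 * s + 5)%N.
  by apply: (D _ _ (D _ _ (X _ _ (C c0) (P _ e0 pS)) (X _ _ (C 3) I)) (C 5)).
have sim : poly_bounded (fun s => c * (4 * s + 1) ^ e + 4)%N.
  exact: (D _ _ (X _ _ (C c) (P _ e (D _ _ (X _ _ (C 4) I) (C 1)))) (C 4)).
have runs : poly_bounded (fun s => (2 * s) ^ 7 * (s + 2))%N.
  exact: (X _ _ (P _ 7 (X _ _ (C 2) I)) (D _ _ I (C 2))).
have cyc := D _ _ len (X _ _ runs sim).
exact: (X _ _ (D _ _ cyc (C 1)) (D _ _ (X _ _ (C 2) (D _ _ (D _ _ len cyc) (C 1))) (C 4))).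
Qed.

(** * From a simulator to a poly-box *)

Section Reduction.
Variables (A : finType) (R : realType) (C : circuit_family A R) (M : PTM (sym A)).
Variables (c e c0 e0 : nat).
Hypothesis C_poly : forall a, (size a + nout C a <= c0 * (nqubits C a).+1 ^ e0)%N.
Variables (a : seq A) (m d : nat) (S : (nout C a).-tuple (option bool)).
Hypotheses (m_gt0 : (0 < m)%N) (d_gt0 : (0 < d)%N).

Let l := size (bin m).
Let L := size (bin d).
Let m' := (m + 2 ^ l)%N.
Let T := (c * (nqubits C a + m').+1 ^ e)%N.
Let w := enc_sim a m'.
Let x := enc_box a m d S.
Let N := (radix ^ l * L.+1)%N.
Let B := (size x + N * (T + 4))%N.

Lemma sim_input : w = map (@sA A) a ++ ssep :: enc_bits (rcons (bin m) true).
Proof. by rewrite /w /enc_sim /enc_nat bin_addtop. Qed.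

Lemma box_time : (B.+1 * ((size x + B.+1).*2 + 4) <=
  run_bound c0 e0 c e (nqubits C a + m + up_log 2 d))%N.
Proof.
set s := (_ + up_log 2 d)%N.
have m_le : (m <= s)%N by rewrite /s; lia.
have pow_l : (2 ^ l <= 2 * m)%N by rewrite mul2n exp_size_bin.
have l_le : (l < 2 * m)%N := leq_trans (ltn_expl l (isT : 1 < 2)%N) pow_l.
have L_le : (L <= (up_log 2 d).+1)%N.
  rewrite -(@leq_exp2l 2) // expnS; apply: leq_trans (exp_size_bin d_gt0) _.
  by rewrite -mul2n leq_mul2l up_logP.
have len_le : (size x <= c0 * s.+1 ^ e0 + 3 * s + 5)%N.
  have inst : (size a + nout C a <= c0 * s.+1 ^ e0)%N.
    apply: leq_trans (C_poly a) _; rewrite leq_mul2l; apply/orP; right.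
    by apply: leq_expl; rewrite /s; lia.
  rewrite /x /enc_box /enc_nat /enc_S; do ?[rewrite !(size_cat, size_map) /=].
  by rewrite size_tuple -/l -/L; move: inst L_le l_le; rewrite /s; lia.
have sim_le : (T <= c * (4 * s + 1) ^ e)%N.
  rewrite /T leq_mul2l; apply/orP; right; apply: leq_expl.
  by move: pow_l; rewrite /m' /s; lia.
have runs_le : (N <= (2 * s) ^ 7 * (s + 2))%N.
  (* The exponent 7 arises from 128^l = (2^l)^7 and 2^l <= 2m. *)
  rewrite /N (_ : radix = 2 ^ 7)%N // -expnM [(7 * l)%N]mulnC expnM.
  by apply: leq_mul; [apply: leq_expl; lia|rewrite /s; lia].
have cyc_le : (B <= c0 * s.+1 ^ e0 + 3 * s + 5 +
    (2 * s) ^ 7 * (s + 2) * (c * (4 * s + 1) ^ e + 4))%N.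
  by rewrite /B leq_add // leq_mul // leq_add2r.
rewrite /run_bound -[B.+1]addn1 -mul2n; apply: leq_mul; first by rewrite leq_add2r.
by rewrite leq_add2r leq_mul2l /= -[in leqRHS]addnA leq_add // leq_add2r.
Qed.

Hypothesis T_halts : halts_within M w T.
Hypothesis close :
  \sum_(y : (nout C a).-tuple bool)
      `|Pdist C a y - prob_out R M w T (fun u => u = enc_bits y)| <= (m'%:R)^-1.

Let p : R := expect (@step _ M) (fun u => (accepts (enc_S S) u)%:R) T (init_config M w).

Lemma accept_prob :
  p = \sum_(y : (nout C a).-tuple bool | agrees S y)
        prob_out R M w T (fun u => u = enc_bits y).
Proof.
under eq_bigr => y _ do rewrite prob_outE.
by rewrite -expect_sum; apply: eq_expect => u; exact: acceptsE.
Qed.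

Lemma accept_prob01 : 0 <= p <= 1.
Proof.
apply/andP; split.
  rewrite -[leLHS](expect_const (@step _ M) 0 T (init_config M w)).
  by apply: expect_le => u; rewrite ler0n.
rewrite -[leRHS](expect_const (@step _ M) 1 T (init_config M w)).
by apply: expect_le => u; case: (accepts _ _).
Qed.

(** The L1 distance dominates the difference of probabilities of any event, and m' >= 2m because m <
    2^l. *)
Lemma accept_close : `|marginal S - p| <= (m.*2%:R)^-1.
Proof.
rewrite accept_prob /marginal -sumrB.
apply: le_trans (ler_norm_sum _ _ _) _.
apply: le_trans (_ : _ <= (m'%:R)^-1) _.
  apply: le_trans close; rewrite big_mkcond /=; apply: ler_sum => y _.
  by case: ifP.
have lt_m : (m.*2 <= m')%N by have := bin_lt_exp m; rewrite /m' -/l; lia.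
by rewrite lef_pV2 ?posrE ?ltr0n ?ler_nat //; lia.
Qed.

Definition wrong (u : seq (sym A)) : Prop :=
  ~ exists (z : int) (dd : nat), [/\ (0 < dd)%N, u = enc_frac z dd &
      `|marginal S - (z%:~R / dd%:R)| < (m%:R)^-1].

Lemma box_correct k : (B.+1 * ((size x + B.+1).*2 + 4) <= k)%N ->
  halts_within (sweep_ptm (estimator M)) x k /\
  prob_out R (sweep_ptm (estimator M)) x k wrong <= (d%:R)^-1.
Proof.
move=> le_k.
have N_gt0 : (0 < N)%N by rewrite /N muln_gt0 expn_gt0.
have m0 : 0 < m%:R :> R by rewrite ltr0n.
have m1 : 1 <= m%:R :> R by rewrite ler1n.
have tE : (m.*2%:R)^-1 = (m%:R)^-1 / 2 :> R by rewrite -mul2n natrM invfM mulrC.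
have i0 : 0 < (m%:R)^-1 :> R by rewrite invr_gt0.
have i1 : (m%:R)^-1 <= 1 :> R by rewrite invf_le1.
pose V j h := deviation p N (m.*2%:R)^-1 j h.
(* With no run left, the potential must dominate the indicator of failure; an answer off by 1/m is
   off by t = 1/(2m) from [p]. *)
have V0 h : (`[< wrong (enc_frac (Posz h) N) >])%:R <= V 0 h.
  case: asboolP => [bad|_]; last exact: deviation_ge0.
  apply: deviation_ge1 => //; first by rewrite invr_ge0.
  have far : (m%:R)^-1 <= `|marginal S - h%:R / N%:R|.
    by rewrite leNgt; apply/negP => lt; apply: bad; exists (Posz h), N.
  have := ler_distD p (marginal S) (h%:R / N%:R); have := accept_close.
  by rewrite tE; move: far; lra.
have VS j h : p * V j h.+1 + (1 - p) * V j h <= V j.+1 h.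
  by apply: deviation_step accept_prob01 _; rewrite tE; apply/andP; split; lra.
have halts : halts_within M (map (@sA A) a ++ ssep :: enc_bits (rcons (bin m) true)) T.
  by rewrite -sim_input.
(* A pattern contains only bits and [sdot], so the shifting stops exactly at its first symbol. *)
have start : head None [seq Some s | s <- enc_S S] != Some (@ssep A).
  by case: (tval S) => [|[[]|] s'].
have pE : p = expect (@step _ M) (fun u => (accepts (enc_S S) u)%:R) T
    (init_config M (map (@sA A) a ++ ssep :: enc_bits (rcons (bin m) true))).
  by rewrite -sim_input.
have bd := @bounded_estimator A M R (fun u => (`[< wrong u >])%:R) a (bin m) (bin d)
  (enc_S S) T p V start halts pE V0 VS.
split=> [r|].
  exact: (bounded_halts (@step_halting _ _) bd le_k (size_tuple r)).
rewrite prob_outE; apply: le_trans (bounded_expect (@step_halting _ _) bd le_k) _.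
exact: deviation_small m_gt0 d_gt0 (bin_lt_exp m) (bin_lt_exp d).
Qed.
End Reduction.

Theorem theorem3 (A : finType) (R : realType) (C : circuit_family A R) :
  ~ poly_box C -> ~ eps_simulator C.
Proof.
apply: contra_not => -[M [c [e sim]]].
have [c0 [e0 C_poly]] := desc_poly C.
have [c1 [e1 time]] := poly_bounded_run_bound c0 e0 c e.
(* Machine and polynomial depend only on the simulator and on the size bounds of the family, which
   gives one poly-box for all inputs. *)
exists (sweep_ptm (estimator M)), c1, e1 => a m d S m_gt0 d_gt0 /=.
have m'_gt0 : (0 < m + 2 ^ size (bin m))%N by rewrite addn_gt0 m_gt0.
have [halts close] := sim a _ m'_gt0.
apply: (box_correct m_gt0 d_gt0 halts).
  apply: le_trans close; rewrite lerDl /prob_out.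
  by rewrite divr_ge0 ?ler0n.
exact: leq_trans (box_time c e C_poly S m_gt0 d_gt0) (time _).
Qed.
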